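(* (One-round point-to-point.) The set of triples $(R_0,R_X,R_Y)$ in the rate region of the function computation problem with $R_Y>R_0+H(Y)$ equals the set of nonnegative triples with $R_Y>R_0+H(Y)$ and $R_0+R_X\ge H(G_{X|Y})$.
   Context: Setup: $\mathcal X,\mathcal Y,\mathcal F$ finite, $(X_i,Y_i)_{i\ge1}$ i.i.d. copies of $(X,Y)\sim p(x,y)$, $f:\mathcal X\times\mathcal Y\to\mathcal F$ applied componentwise to sequences. An $(n,R_0,R_X,R_Y)$ code consists of encoders $\varphi_0:\mathcal X^n\to\{1,\dots,2^{nR_0}\}$, $\varphi_X:\mathcal X^n\to\{1,\dots,2^{nR_X}\}$, $\varphi_Y:\mathcal Y^n\times\{1,\dots,2^{nR_0}\}\to\{1,\dots,2^{nR_Y}\}$ and a decoder $\psi:\{1,\dots,2^{nR_X}\}\times\{1,\dots,2^{nR_Y}\}\to\mathcal F^n$, with error probability $P(\psi(\varphi_X(\mathbf X),\varphi_Y(\varphi_0(\mathbf X),\mathbf Y))\ne f(\mathbf X,\mathbf Y))$. A triple is achievable if for every $\varepsilon>0$ and all large $n$ a code with error probability $\le\varepsilon$ exists; the rate region is the closure of the achievable set. $G_{X|Y}$ is the graph with vertex set $\mathcal X$ in which $x_1,x_2$ are adjacent iff there is $y$ with $p(x_1,y)p(x_2,y)>0$ and $f(x_1,y)\ne f(x_2,y)$. The conditional graph entropy is $H(G_{X|Y})=\min I(V;X|Y)$, the minimum over random variables $V$ with $V-X-Y$ Markov, each value of $V$ being an independent set of $G_{X|Y}$, and $P(X\in V)=1$.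 *)

(* Defs.v *)
From mathcomp Require Import all_boot.
From Stdlib Require Import Reals ZArith ClassicalEpsilon.

Set Implicit Arguments.
Unset Strict Implicit.
Unset Printing Implicit Defensive.

Local Open Scope R_scope.

Section Defs.
Variables (X Y F : finType).
Variable (p : X -> Y -> R).
Variable (f : X -> Y -> F).

Definition is_pmf : Prop :=
  (forall x y, 0 <= p x y) /\ \big[Rplus/0]_(x : X) \big[Rplus/0]_(y : Y) p x y = 1.

Definition log2 (r : R) : R := ln r / ln 2.

Definition pY (y : Y) : R := \big[Rplus/0]_(x : X) p x y.

Definition entropyY : R :=
  - \big[Rplus/0]_(y : Y) (if Rlt_dec 0 (pY y) then pY y * log2 (pY y) else 0).

Definition adjacent (x1 x2 : X) : Prop :=
  exists y : Y, 0 < p x1 y * p x2 y /\ f x1 y <> f x2 y.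

Definition independent (S : {set X}) : Prop :=
  forall x1 x2, x1 \in S -> x2 \in S -> ~ adjacent x1 x2.

Definition pX (x : X) : R := \big[Rplus/0]_(y : Y) p x y.

(* A random variable V with V - X - Y Markov is given by a conditional pmf
   q(v|x) = q x v, so that P(V=v,X=x,Y=y) = p(x,y) q(v|x).  Every value of V
   (v with P(V=v) > 0) is an independent set of G_{X|Y}, and P(X \in V) = 1. *)
Definition admissible (q : X -> {set X} -> R) : Prop :=
  (forall x v, 0 <= q x v) /\
  (forall x, \big[Rplus/0]_(v : {set X}) q x v = 1) /\
  (forall x v, 0 < pX x * q x v -> independent v) /\
  (forall x v, 0 < pX x * q x v -> x \in v).

Definition pVXY (q : X -> {set X} -> R) (v : {set X}) (x : X) (y : Y) : R :=
  p x y * q x v.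
Definition pVY (q : X -> {set X} -> R) (v : {set X}) (y : Y) : R :=
  \big[Rplus/0]_(x : X) pVXY q v x y.

Definition condMI (q : X -> {set X} -> R) : R :=
  \big[Rplus/0]_(v : {set X}) \big[Rplus/0]_(x : X) \big[Rplus/0]_(y : Y)
    (if Rlt_dec 0 (pVXY q v x y)
     then pVXY q v x y * log2 (pVXY q v x y * pY y / (pVY q v y * p x y))
     else 0).

Definition is_condGraphEntropy (h : R) : Prop :=
  (exists q, admissible q /\ condMI q = h) /\
  (forall q, admissible q -> h <= condMI q).

Definition condGraphEntropy : R :=
  epsilon (inhabits 0) is_condGraphEntropy.

(* message set size: {1,...,2^{nR}} has floor(2^{nR}) elements *)
Definition msgs (n : nat) (r : R) : nat :=
  Z.to_nat (Int_part (Rpower 2 (INR n * r))).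

Definition seq_prob (n : nat) (xs : {ffun 'I_n -> X}) (ys : {ffun 'I_n -> Y}) : R :=
  \big[Rmult/1]_(i < n) p (xs i) (ys i).

Definition code_error (n : nat) (R0 RX RY : R)
  (phi0 : {ffun 'I_n -> X} -> 'I_(msgs n R0))
  (phiX : {ffun 'I_n -> X} -> 'I_(msgs n RX))
  (phiY : {ffun 'I_n -> Y} -> 'I_(msgs n R0) -> 'I_(msgs n RY))
  (psi : 'I_(msgs n RX) -> 'I_(msgs n RY) -> {ffun 'I_n -> F}) : R :=
  \big[Rplus/0]_(xs : {ffun 'I_n -> X}) \big[Rplus/0]_(ys : {ffun 'I_n -> Y})
    (if psi (phiX xs) (phiY ys (phi0 xs)) == [ffun i => f (xs i) (ys i)]
     then 0 else seq_prob xs ys).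

Definition achievable (R0 RX RY : R) : Prop :=
  forall eps : R, 0 < eps ->
  exists N : nat, forall n : nat, (N <= n)%nat ->
  exists phi0 phiX phiY psi, @code_error n R0 RX RY phi0 phiX phiY psi <= eps.

Definition rate_region (R0 RX RY : R) : Prop :=
  forall eps : R, 0 < eps ->
  exists R0' RX' RY', achievable R0' RX' RY' /\
    Rabs (R0 - R0') <= eps /\ Rabs (RX - RX') <= eps /\ Rabs (RY - RY') <= eps.
End Defs.

(* Main.v *)
(** Converse: let the decoder know Y^n and the pair M of both indices sent by X.
    With U_i the function y |-> (i-th output when Y_i is replaced by y), each
    U_i - X_i - Y_i is Markov, and the conditional informations I(U_i; X_i | Y_i)
    sum to the mean logarithm of prod_i P(X_i | U_i, Y_i) / P(X_i | Y_i).  The mean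
    of that product is at most the number of messages, so some letter has
    information at most R0 + RX while U_i(Y_i) misses f(X_i, Y_i) with small
    probability.  Compactness lets the error tend to 0, and each value of U is then
    replaced by the independent set of the inputs consistent with it.

    Achievability: Y forwards X's first index together with its own sequence, so
    the decoder has Y^n and R0 + RX bits about X^n.  Random codewords drawn from
    the law of V^n, randomly binned, let it recover a sequence of independent sets
    containing the letters of X^n (Wyner-Ziv coding), which together with Y^n
    determines f. *)

Require Import Defs.
From HB Require Import structures.
From mathcomp Require Import all_boot.
From Stdlib Require Import Reals Lra Lia ZArith Classical ClassicalEpsilon.

Set Implicit Arguments.
Unset Strict Implicit.
Unset Printing Implicit Defensive.

Local Open Scope R_scope.

(** The letters [U_i] take values in [{ffun Y -> F}], an alphabet that depends neither on the
    blocklength nor on the code. With the message and the other [Y_j] themselves as auxiliary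
    variable, the alphabets would grow with [n] and the test channels would have no common compact
    space to converge in. The limit is unavoidable: only at error exactly 0 does every value of [U]
    of positive probability agree with [f] on the support of [p], which is what turns it into an
    independent set.

    Achievability avoids typical sets. A one-shot bound for arbitrary finite alphabets is stated
    with thresholds on the two ratios P(v|x)/P(v) and P(v,y)/(P(v)P(y)). For product laws their
    logarithms are sums of independent terms, so a Chernoff bound suffices. By the Markov chain
    I(V;X|Y) = I(V;X) - I(V;Y): the first term is the exponent of the codebook size, the second the
    exponent of the number of codewords that may share a bin.

    Information is measured in nats until the end, which explains the factors [ln 2] next to
    rates. *)

HB.instance Definition _ := Monoid.isComLaw.Build R 0 Rplus
  (fun x y z => esym (Rplus_assoc x y z)) Rplus_comm Rplus_0_l.
HB.instance Definition _ := Monoid.isComLaw.Build R 1 Rmult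
  (fun x y z => esym (Rmult_assoc x y z)) Rmult_comm Rmult_1_l.
HB.instance Definition _ := Monoid.isMulLaw.Build R 0 Rmult Rmult_0_l Rmult_0_r.
HB.instance Definition _ := Monoid.isAddLaw.Build R Rmult Rplus
  Rmult_plus_distr_r Rmult_plus_distr_l.

Local Notation "\sum_ i F" := (\big[Rplus/0%R]_i F%R) : R_scope.
Local Notation "\sum_ ( i : t ) F" := (\big[Rplus/0%R]_(i : t) F%R) : R_scope.
Local Notation "\sum_ ( i < n ) F" := (\big[Rplus/0%R]_(i < n) F%R) : R_scope.
Local Notation "\sum_ ( i 'in' A ) F" := (\big[Rplus/0%R]_(i in A) F%R) : R_scope.
Local Notation "\sum_ ( i | P ) F" := (\big[Rplus/0%R]_(i | P) F%R) : R_scope.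
Local Notation "\prod_ i F" := (\big[Rmult/1%R]_i F%R) : R_scope.
Local Notation "\prod_ ( i < n ) F" := (\big[Rmult/1%R]_(i < n) F%R) : R_scope.

(** * Finite sums and products of real numbers *)

Section Sums.
Variables (I : finType).
Implicit Types (P : pred I) (F G : I -> R).

Lemma sumR_ge0 P F : (forall i, 0 <= F i) -> 0 <= \sum_(i | P i) F i.
Proof. by move=> h; elim/big_ind: _ => [|x y|i _]; [lra|lra|exact: h]. Qed.

Lemma sumR_le P F G : (forall i, F i <= G i) ->
  \sum_(i | P i) F i <= \sum_(i | P i) G i.
Proof. by move=> h; elim/big_ind2: _ => [|x y z t|i _]; [lra|lra|exact: h]. Qed.

Lemma term_le_sumR F i : (forall j, 0 <= F j) -> F i <= \sum_j F j.
Proof.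
move=> h; rewrite (bigD1 i) //=.
have := sumR_ge0 (fun j => j != i) h; lra.
Qed.

Lemma sumR_eq0 F i : (forall j, 0 <= F j) -> \sum_j F j = 0 -> F i = 0.
Proof. by move=> h e; have := term_le_sumR i h; have := h i; lra. Qed.

Lemma sumR_const (x : R) : \sum_(i : I) x = INR #|I| * x.
Proof.
rewrite big_const; elim: #|I| => [|n IH]; first by rewrite /=; lra.
by rewrite iterS IH S_INR; lra.
Qed.

Lemma sumR_add F G : \sum_i (F i + G i) = \sum_i F i + \sum_i G i.
Proof. exact: big_split. Qed.

Lemma sumR_opp F : \sum_i (- F i) = - \sum_i F i.
Proof. by symmetry; apply: (big_morph Ropp) => [x y|]; lra. Qed.

Lemma prodR_ge0 F : (forall i, 0 <= F i) -> 0 <= \prod_i F i.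
Proof. by move=> h; elim/big_ind: _ => [|x y|i _]; [lra|exact: Rmult_le_pos|exact: h]. Qed.

Lemma prodR_gt0 F : (forall i, 0 < F i) -> 0 < \prod_i F i.
Proof. by move=> h; elim/big_ind: _ => [|x y|i _]; [lra|exact: Rmult_lt_0_compat|exact: h]. Qed.

Lemma prodR_gt0P F i : (forall j, 0 <= F j) -> 0 < \prod_j F j -> 0 < F i.
Proof.
move=> h; rewrite (bigD1 i) //= => H; case: (h i) => // e.
by move: H; rewrite -e Rmult_0_l; lra.
Qed.

Lemma prodR_le1 F : (forall i, 0 <= F i <= 1) -> \prod_i F i <= 1.
Proof.
move=> h; have: 0 <= \prod_i F i <= 1; last by case.
by elim/big_ind: _ => [|x y|i _]; [lra|nra|exact: h].
Qed.

Lemma ln_prodR F : (forall i, 0 < F i) -> ln (\prod_i F i) = \sum_i ln (F i).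
Proof.
move=> h; suff [] : 0 < \prod_i F i /\ ln (\prod_i F i) = \sum_i ln (F i) by [].
elim/big_ind2: _ => [|x y z t [x0 <-] [z0 <-]|i _].
- by rewrite ln_1; split; lra.
- by split; [exact: Rmult_lt_0_compat|rewrite ln_mult].
- by split; first exact: h.
Qed.

Lemma exp_sumR F : exp (\sum_i F i) = \prod_i exp (F i).
Proof. by apply: (big_morph exp) => [x y|]; [exact: exp_plus|exact: exp_0]. Qed.

Lemma prodR_const (x : R) n : \prod_(i < n) x = x ^ n.
Proof. by rewrite big_const card_ord; elim: n => [|n IH] //=; rewrite -IH. Qed.

(** The averaging argument that fixes a good codebook, then a good binning, and in the converse a
    good letter. *)
Lemma exists_le_mean (w E : I -> R) (t : R) : (forall i, 0 <= w i) ->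
  \sum_i w i = 1 -> \sum_i w i * E i <= t -> exists i, E i <= t.
Proof.
move=> w0 w1 h; apply: NNPP => /not_ex_all_not nE.
have tE i : t < E i by apply: Rnot_le_lt; exact: nE.
have pos i : 0 <= w i * (E i - t) by apply: Rmult_le_pos; [|have := tE i; lra].
have e : \sum_i w i * (E i - t) = \sum_i w i * E i - t.
  rewrite (eq_bigr (fun i => w i * E i + w i * - t)); last by move=> i _; ring.
  by rewrite big_split /= -big_distrl /= w1; ring.
have z : \sum_i w i * (E i - t) = 0.
  by apply: Rle_antisym; [rewrite e; lra|exact: sumR_ge0].
suff : \sum_i w i = 0 by lra.
by apply: big1 => i _; case: (Rmult_integral _ _ (sumR_eq0 i pos z)) => //; have := tE i; lra.
Qed.

End Sums.

(** Taking a [Prop] lets real inequalities and quantified events be weighted without boolean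
    versions of them. *)
Definition indic (P : Prop) : R := if excluded_middle_informative P then 1 else 0.

Lemma indic1 (P : Prop) : P -> indic P = 1.
Proof. by rewrite /indic; case: excluded_middle_informative. Qed.

Lemma indic0 (P : Prop) : ~ P -> indic P = 0.
Proof. by rewrite /indic; case: excluded_middle_informative. Qed.

Lemma indic_ge0 (P : Prop) : 0 <= indic P.
Proof. by rewrite /indic; case: (excluded_middle_informative P) => h /=; lra. Qed.

Lemma indic_le1 (P : Prop) : indic P <= 1.
Proof. by rewrite /indic; case: (excluded_middle_informative P) => h /=; lra. Qed.

Lemma indic_le (P Q : Prop) : (P -> Q) -> indic P <= indic Q.
Proof.
move=> h; case: (classic P) => p; first by rewrite !indic1 //; [lra|exact: h].
by rewrite (indic0 p); exact: indic_ge0.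
Qed.

Lemma indic_not (P : Prop) : indic (~ P) = 1 - indic P.
Proof.
case: (classic P) => h; first by rewrite (indic1 h) indic0 //; lra.
by rewrite (indic0 h) indic1 //; lra.
Qed.

Lemma sum_indic_eq (A : finType) (a : A) (g : A -> R) :
  \sum_b indic (a = b) * g b = g a.
Proof.
rewrite (bigD1 a) //= indic1 // big1 => [|b /eqP ne]; first by ring.
by rewrite indic0 ?Rmult_0_l // => e; apply: ne.
Qed.

(** * Product measures *)

Section ProductMeasure.
Variables (I A : finType).
Implicit Types (z : {ffun I -> A}).

Definition upd z (i : I) (a : A) : {ffun I -> A} :=
  [ffun j => if j == i then a else z j].

Lemma upd_same z i a : upd z i a i = a.
Proof. by rewrite ffunE eqxx. Qed.

Lemma upd_id z i : upd z i (z i) = z.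
Proof. by apply/ffunP => j; rewrite ffunE; case: eqP => // ->. Qed.

Lemma upd_upd z i a b : upd (upd z i a) i b = upd z i b.
Proof. by apply/ffunP => j; rewrite !ffunE; case: eqP. Qed.

Lemma sum_prodR (h : I -> A -> R) :
  \sum_(z : {ffun I -> A}) \prod_i h i (z i) = \prod_i \sum_a h i a.
Proof. by rewrite bigA_distr_bigA. Qed.

Variable w : A -> R.
Hypothesis w1 : \sum_a w a = 1.

Lemma sum_prodR1 : \sum_(z : {ffun I -> A}) \prod_i w (z i) = 1.
Proof. by rewrite (sum_prodR (fun _ => w)) w1 big1. Qed.

(* The involution exchanging the i-th coordinate of z with an independent copy
   a preserves the product weight. *)
Lemma resample (i : I) (h : {ffun I -> A} -> R) :
  \sum_(z : {ffun I -> A}) (\prod_j w (z j)) * h z =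
  \sum_a w a * \sum_(z : {ffun I -> A}) (\prod_j w (z j)) * h (upd z i a).
Proof.
transitivity (\sum_(u : A * {ffun I -> A}) w u.1 * ((\prod_j w (u.2 j)) * h u.2)).
  rewrite -(pair_bigA _ (fun a (z : {ffun I -> A}) => w a * ((\prod_j w (z j)) * h z))) /=.
  rewrite exchange_big /=; apply: eq_bigr => z _.
  by rewrite -big_distrl /= w1 Rmult_1_l.
pose sw (u : A * {ffun I -> A}) := (u.2 i, upd u.2 i u.1).
have swK : involutive sw.
  by case=> a z; rewrite /sw /= upd_same upd_upd upd_id.
rewrite (reindex_inj (inv_inj swK)) /=.
under [RHS]eq_bigr => a _ do rewrite big_distrr /=.
rewrite (pair_bigA _ (fun a (z : {ffun I -> A}) => w a * ((\prod_j w (z j)) * h (upd z i a)))) /=.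
apply: eq_bigr => -[a z] _ /=.
have e : w (z i) * (\prod_j w (upd z i a j)) = w a * \prod_j w (z j).
  rewrite (bigD1 i) //= [in RHS](bigD1 i) //= upd_same.
  rewrite (eq_bigr (fun j => w (z j))); last by move=> j /negbTE ne; rewrite ffunE ne.
  by rewrite -2!Rmult_assoc (Rmult_comm (w a)).
by rewrite -!Rmult_assoc e.
Qed.

Lemma sum_prodR_coord (i : I) (g : A -> R) :
  \sum_(z : {ffun I -> A}) (\prod_j w (z j)) * g (z i) = \sum_a w a * g a.
Proof.
rewrite (resample i); apply: eq_bigr => a _; congr (_ * _).
under eq_bigr => z _ do rewrite upd_same.
by rewrite -big_distrl /= sum_prodR1 Rmult_1_l.
Qed.

(** Pairwise independence of coordinates. For the uniform weight on bins the right side is one over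
    the number of bins: the chance that two codewords share a bin. *)
Lemma sum_prodR_collision (i k : I) : k <> i ->
  \sum_(z : {ffun I -> A}) (\prod_j w (z j)) * indic (z k = z i) =
  \sum_a w a * w a.
Proof.
move=> ne; rewrite (resample i); apply: eq_bigr => a _; congr (_ * _).
transitivity (\sum_(z : {ffun I -> A}) (\prod_j w (z j)) * indic (a = z k)).
  apply: eq_bigr => z _; congr (_ * _); rewrite upd_same ffunE.
  case: eqP => // _; case: (classic (a = z k)) => e; first by rewrite !indic1.
  by rewrite !indic0 // => e'; apply: e.
rewrite (sum_prodR_coord k (fun b => indic (a = b))).
by under eq_bigr => b _ do rewrite Rmult_comm; rewrite sum_indic_eq.
Qed.

End ProductMeasure.

Lemma sum_ffun_pair (I A B : finType) (h : {ffun I -> A} -> {ffun I -> B} -> R) :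
  \sum_a \sum_b h a b =
  \sum_(z : {ffun I -> A * B}) h [ffun i => (z i).1] [ffun i => (z i).2].
Proof.
rewrite pair_bigA /=.
pose s (z : {ffun I -> A * B}) := ([ffun i => (z i).1], [ffun i => (z i).2]).
rewrite (reindex s) //=; exists (fun u : {ffun I -> A} * {ffun I -> B} => [ffun i => (u.1 i, u.2 i)]) => [z|[a b]] _.
  by apply/ffunP => i; rewrite !ffunE; case: (z i).
by congr pair; apply/ffunP => i; rewrite !ffunE.
Qed.

(** From [exp (- t) >= 1 - t], and (1 - t)(1 + t + 2 t^2) = 1 + t^2 (1 - 2 t) >= 1. *)
Lemma exp_le_quadratic (t : R) : t <= 1 / 2 -> exp t <= 1 + t + 2 * t ^ 2.
Proof.
move=> ht; have e1 := exp_ineq1_le (- t); have e2 := exp_plus t (- t).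
rewrite Rplus_opp_r exp_0 in e2; have e3 := exp_pos t; nra.
Qed.

(* The moment generating function of [g] has negative derivative at 0, so it is
   < 1 at a small positive parameter. *)
Lemma chernoff (A : finType) (w g : A -> R) :
  (forall a, 0 <= w a) -> \sum_a w a = 1 -> \sum_a w a * g a < 0 ->
  exists rho, 0 <= rho < 1 /\ forall n : nat,
    \sum_(z : {ffun 'I_n -> A}) (\prod_i w (z i)) * indic (0 <= \sum_i g (z i))
    <= rho ^ n.
Proof.
move=> w0 w1 h; pose delta := - \sum_a w a * g a.
have d0 : 0 < delta by rewrite /delta; lra.
pose K := 1 + \sum_a Rabs (g a).
have gK a : Rabs (g a) <= K.
  have := term_le_sumR a (fun b => Rabs_pos (g b)); rewrite /K; lra.
have K1 : 1 <= K by have := sumR_ge0 xpredT (fun b => Rabs_pos (g b)); rewrite /K; lra.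
have dK : delta <= K.
  rewrite /delta -sumR_opp -[K]Rmult_1_l -w1 big_distrl /=; apply: sumR_le => a.
  by have := w0 a; have := gK a; have := Rle_abs (- g a); rewrite Rabs_Ropp; nra.
(* This choice makes [2 * s ^ 2 * K ^ 2] equal to half of [s * delta], so [rho] is at most 1 - s
   delta / 2. Since [delta <= K], also [s * K <= 1 / 4], within the range of [exp_le_quadratic]. *)
pose s := delta / (4 * K ^ 2).
have s0 : 0 < s by apply: Rdiv_lt_0_compat; nra.
have sK2 : 4 * (s * K ^ 2) = delta by rewrite /s; field; lra.
have sK : s * K <= 1 / 4 by nra.
pose rho := \sum_a w a * exp (s * g a).
have r0 : 0 <= rho.
  by apply: sumR_ge0 => a; apply: Rmult_le_pos => //; left; exact: exp_pos.
exists rho; split.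
  split=> //; apply: (Rle_lt_trans _ (1 - s * delta + 2 * s ^ 2 * K ^ 2)); last by nra.
  have -> : 1 - s * delta + 2 * s ^ 2 * K ^ 2 =
    \sum_a w a * (1 + s * g a + 2 * s ^ 2 * K ^ 2).
    rewrite (eq_bigr (fun a => w a * g a * s + w a * (1 + 2 * s ^ 2 * K ^ 2))).
      by rewrite big_split /= -!big_distrl /= w1 /delta; ring.
    by move=> a _; ring.
  apply: sumR_le => a; apply: Rmult_le_compat_l => //.
  have [ga1 ga2] : - K <= g a <= K by have := gK a; split_Rabs; lra.
  have := @exp_le_quadratic (s * g a); have : g a ^ 2 <= K ^ 2 by nra.
  have : 0 <= s ^ 2 by nra.
  move=> s2 gk /(_ _); nra.
move=> n.
apply: (Rle_trans _ (\sum_(z : {ffun 'I_n -> A}) \prod_i (w (z i) * exp (s * g (z i))))).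
  apply: sumR_le => z; rewrite big_split /=; apply: Rmult_le_compat_l.
    exact: prodR_ge0.
  have <- : exp (s * \sum_i g (z i)) = \prod_i exp (s * g (z i)).
    by rewrite -exp_sumR -big_distrr.
  case: (classic (0 <= \sum_i g (z i))) => hz.
    rewrite indic1 //; have := exp_ineq1_le (s * \sum_i g (z i)).
    have := Rmult_le_pos _ _ (Rlt_le _ _ s0) hz; lra.
  by rewrite indic0 //; left; exact: exp_pos.
rewrite (sum_prodR (fun _ a => w a * exp (s * g a))) prodR_const.
exact: Rle_refl.
Qed.

(** * One-shot coding with side information at the decoder *)

(** Convexity of the power: [1 - a * b] is the mean of [1] and [1 - b] with weights [1 - a] and [a].
    It bounds the chance that none of [M] random codewords covers a source word. *)
Lemma pow_one_minus_le (a b : R) (M : nat) : 0 <= a <= 1 -> 0 <= b <= 1 ->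
  (1 - a * b) ^ M <= 1 - a + exp (- (INR M * b)).
Proof.
move=> ha hb; have ab : 0 <= a * b <= 1 by nra.
have base : (1 - a * b) ^ M <= 1 - a + a * (1 - b) ^ M.
  elim: M => [|M IH] /=; first by lra.
  have h1 : 0 <= (1 - b) ^ M by apply: pow_le; lra.
  have h2 : (1 - b) ^ M <= 1.
    by have := pow_incr (1 - b) 1 M; rewrite pow1; apply; lra.
  apply: (Rle_trans _ ((1 - a * b) * (1 - a + a * (1 - b) ^ M))).
    by apply: Rmult_le_compat_l => //; lra.
  have : 0 <= a * b * (1 - a) * (1 - (1 - b) ^ M).
    by apply: Rmult_le_pos; [apply: Rmult_le_pos; lra|lra].
  by move: h1 h2; set u := (1 - b) ^ M => h1 h2; lra.
have e : (1 - b) ^ M <= exp (- (INR M * b)).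
  have -> : exp (- (INR M * b)) = exp (- b) ^ M.
    elim: (M) => [|k IH]; first by rewrite /= Rmult_0_l Ropp_0 exp_0.
    by rewrite S_INR /= -IH -exp_plus; congr exp; ring.
  by apply: pow_incr; have := exp_ineq1_le (- b); lra.
have := exp_pos (- (INR M * b)); nra.
Qed.

Definition outV (X Y V : finType) (P : X -> Y -> R) (Q : X -> V -> R) (v : V) : R :=
  \sum_x pX P x * Q x v.
Definition outVY (X Y V : finType) (P : X -> Y -> R) (Q : X -> V -> R)
  (v : V) (y : Y) : R := \sum_x P x y * Q x v.

Section OneShot.
Variables (X Y V B : finType) (P : X -> Y -> R) (Q : X -> V -> R).
Hypothesis P0 : forall x y, 0 <= P x y.
Hypothesis P1 : \sum_x \sum_y P x y = 1.
Hypothesis Q0 : forall x v, 0 <= Q x v.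
Hypothesis Q1 : forall x, \sum_v Q x v = 1.
Hypothesis B0 : (0 < #|B|)%nat.
Variables (M : nat) (c d s : R).
Hypothesis s0 : 0 < s.
Hypothesis c0 : 0 <= c.

Local Notation I := 'I_M.+1.

Let PX := pX P.
Let PY := pY P.
Let PV := outV P Q.
Let PVY := outVY P Q.

Lemma pX_ge0 x : 0 <= PX x. Proof. exact: sumR_ge0. Qed.
Lemma sum_pX : \sum_x PX x = 1. Proof. exact: P1. Qed.
Lemma pY_ge0 y : 0 <= PY y. Proof. by apply: sumR_ge0. Qed.
Lemma sum_pY : \sum_y PY y = 1. Proof. by rewrite -P1 exchange_big. Qed.
Lemma outV_ge0 v : 0 <= PV v.
Proof. by apply: sumR_ge0 => x; apply: Rmult_le_pos => //; exact: pX_ge0. Qed.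
Lemma sum_outV : \sum_v PV v = 1.
Proof.
rewrite exchange_big -sum_pX; apply: eq_bigr => x _.
by rewrite -big_distrr /= Q1 Rmult_1_r.
Qed.
Lemma outVY_ge0 v y : 0 <= PVY v y.
Proof. by apply: sumR_ge0 => x; apply: Rmult_le_pos. Qed.
Lemma sum_outVY_V y : \sum_v PVY v y = PY y.
Proof.
rewrite exchange_big; apply: eq_bigr => x _.
by rewrite -big_distrr /= Q1 Rmult_1_r.
Qed.
Lemma sum_outVY_Y v : \sum_y PVY v y = PV v.
Proof. by rewrite exchange_big; apply: eq_bigr => x _; rewrite -big_distrl. Qed.

(** A threshold test on the information density of [v] and [y]. By change of measure a codeword
    drawn from [PV] independently of [y] passes with probability at most [exp (- d)], which gives
    [mean_load]. *)
Definition decodable (v : V) (y : Y) : Prop := exp d * PV v * PY y <= PVY v y.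

Let miss x v := \sum_y P x y * indic (~ decodable v y).

(* The last clause replaces the Markov lemma: given x, the codeword selected by
   the encoder is independent of the side information y. *)
Definition encodable (x : X) (v : V) : Prop :=
  [/\ 0 < Q x v, Q x v <= exp c * PV v & miss x v <= s * PX x].

Let mass x := \sum_v PV v * indic (encodable x v).

(** Change of measure: the second clause of [encodable] makes [PV v] at least [exp (- c)] times
    [Q x v], so [mass x] is at least [exp (- c)] times the probability under [Q x]. Then
    [pow_one_minus_le] applies. *)
Lemma uncoverable_le x :
  (1 - mass x) ^ M.+1 <= 1 - \sum_v Q x v * indic (encodable x v) +
    exp (- (INR M.+1 * exp (- c))).
Proof.
set a := \sum_v Q x v * indic (encodable x v).
have a0 : 0 <= a by apply: sumR_ge0 => v; apply: Rmult_le_pos => //; exact: indic_ge0.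
have a1 : a <= 1.
  rewrite -(Q1 x); apply: sumR_le => v.
  by have := Q0 x v; have := indic_le1 (encodable x v); nra.
have b1 : exp (- c) <= 1.
  by case: c0 => [lt|<-]; [left; rewrite -exp_0; apply: exp_increasing; lra|rewrite Ropp_0 exp_0; lra].
have b0 := exp_pos (- c).
have le : a * exp (- c) <= mass x.
  rewrite /a big_distrl /=; apply: sumR_le => v.
  case: (classic (encodable x v)) => h; last by rewrite (indic0 h); lra.
  rewrite (indic1 h) !Rmult_1_r; case: h => _ h _.
  have : exp c * exp (- c) = 1 by rewrite -exp_plus Rplus_opp_r exp_0.
  by have := exp_pos c; have := outV_ge0 v; nra.
have m1 : mass x <= 1.
  rewrite -sum_outV; apply: sumR_le => v.
  by have := outV_ge0 v; have := indic_le1 (encodable x v); nra.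
apply: Rle_trans (pow_one_minus_le M.+1 (conj a0 a1) (conj (Rlt_le _ _ b0) b1)).
by apply: pow_incr; lra.
Qed.

(** When no index qualifies, [epsilon] returns an arbitrary one, here and in [dec]; [err_pointwise]
    charges these cases as errors. *)
Let enc (C : {ffun I -> V}) x : I := epsilon (inhabits ord0) (fun m => encodable x (C m)).
Let dec (C : {ffun I -> V}) (b : {ffun I -> B}) (k : B) y : V :=
  C (epsilon (inhabits ord0) (fun m => b m = k /\ decodable (C m) y)).

(** The decoded value need not be the codeword chosen by the encoder. Lying in the support of [Q x]
    is enough, because for an admissible channel and a possible [x] this already makes it an
    independent set containing [x]. *)
Let err (C : {ffun I -> V}) (b : {ffun I -> B}) :=
  \sum_x \sum_y P x y * indic (~ 0 < Q x (dec C b (b (enc C x)) y)).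

Let uncovered (C : {ffun I -> V}) x := indic (forall m, ~ encodable x (C m)).

Lemma enc_spec (C : {ffun I -> V}) x : ~ (forall m, ~ encodable x (C m)) -> encodable x (C (enc C x)).
Proof. by move=> /not_all_not_ex ex; apply: (epsilon_spec (inhabits ord0) _ ex). Qed.

(** Union bound over three failures: no codeword suits [x]; the chosen one fails the test against
    [y]; another one in its bin passes. Otherwise the chosen codeword is the only candidate, and the
    first clause of [encodable] puts it in the support of [Q x]. *)
Lemma err_pointwise (C : {ffun I -> V}) (b : {ffun I -> B}) x y :
  indic (~ 0 < Q x (dec C b (b (enc C x)) y)) <=
  uncovered C x
  + indic (encodable x (C (enc C x)) /\ ~ decodable (C (enc C x)) y)
  + \sum_m indic (m <> enc C x) * indic (b m = b (enc C x)) * indic (decodable (C m) y).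
Proof.
set S := (X in _ + X).
have S0 m : 0 <= indic (m <> enc C x) * indic (b m = b (enc C x)) * indic (decodable (C m) y).
  by apply: Rmult_le_pos; [apply: Rmult_le_pos|]; exact: indic_ge0.
have S00 : 0 <= S by exact: sumR_ge0.
have u0 : 0 <= uncovered C x by exact: indic_ge0.
set T := indic (_ /\ _); have T0 : 0 <= T by exact: indic_ge0.
have l1 := indic_le1 (~ 0 < Q x (dec C b (b (enc C x)) y)).
case: (classic (forall m, ~ encodable x (C m))) => [un|/enc_spec E].
  by move: l1; rewrite /uncovered (indic1 un); lra.
case: (classic (decodable (C (enc C x)) y)) => [D|nD]; last first.
  have T1 : T = 1 by exact: indic1. lra.
have [] := epsilon_spec (inhabits ord0) (fun m => b m = b (enc C x) /\ decodable (C m) y)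
  (ex_intro _ (enc C x) (conj erefl D)).
rewrite /dec; set m := epsilon _ _ => bm Dm.
case: (classic (m = enc C x)) => [->|ne].
  have [q _ _] := E; have -> : indic (~ 0 < Q x (C (enc C x))) = 0 by apply: indic0 => /(_ q).
  by lra.
have := term_le_sumR m S0; rewrite (indic1 ne) (indic1 bm) (indic1 Dm) -/S.
by move: l1; rewrite /dec -/m; lra.
Qed.

Let wB (_ : B) := / INR #|B|.
Let cardB : 0 < INR #|B|.
Proof. by apply: lt_0_INR; apply/ltP. Qed.
Let wB1 : \sum_k wB k = 1.
Proof. by rewrite sumR_const /wB; field; lra. Qed.
Let wB0 k : 0 <= wB k.
Proof. by left; exact: Rinv_0_lt_compat. Qed.

Let load (C : {ffun I -> V}) := \sum_x \sum_y P x y * \sum_m indic (decodable (C m) y).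

(** Only the binning is averaged here. The loss from an undecodable choice is at most [s] for every
    codebook, by the [miss] clause of [encodable]. *)
Lemma mean_err_bins (C : {ffun I -> V}) :
  \sum_(b : {ffun I -> B}) (\prod_j wB (b j)) * err C b <=
  \sum_x PX x * uncovered C x + s + / INR #|B| * load C.
Proof.
set E := enc C.
pose lost := \sum_x \sum_y P x y * indic (encodable x (C (E x)) /\ ~ decodable (C (E x)) y).
have lost_le : lost <= s.
  rewrite -[s]Rmult_1_r -sum_pX big_distrr /=; apply: sumR_le => x.
  case: (classic (encodable x (C (E x)))) => h.
    case: (h) => _ _; apply: Rle_trans; apply: sumR_le => y.
    by apply: Rmult_le_compat_l => //; apply: indic_le => -[].
  rewrite big1 => [|y _]; first by apply: Rmult_le_pos; [lra|exact: pX_ge0].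
  by rewrite indic0 ?Rmult_0_r // => -[].
suff : \sum_(b : {ffun I -> B}) (\prod_j wB (b j)) * err C b <=
  \sum_x PX x * uncovered C x + lost + / INR #|B| * load C by lra.
have -> : \sum_x PX x * uncovered C x + lost + / INR #|B| * load C =
  \sum_x \sum_y P x y * (uncovered C x +
    indic (encodable x (C (E x)) /\ ~ decodable (C (E x)) y) +
    / INR #|B| * \sum_m indic (decodable (C m) y)).
  rewrite /load big_distrr /= -!big_split /=; apply: eq_bigr => x _.
  rewrite /PX /pX big_distrl /= big_distrr /= -!big_split /=; apply: eq_bigr => y _.
  by rewrite !Rmult_plus_distr_l; congr (_ + _); rewrite -!Rmult_assoc (Rmult_comm (/ _)).
under [X in X <= _]eq_bigr => b _ do rewrite /err big_distrr /=.
rewrite exchange_big /=; apply: sumR_le => x.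
under [X in X <= _]eq_bigr => b _ do rewrite big_distrr /=.
rewrite exchange_big /=; apply: sumR_le => y.
under [X in X <= _]eq_bigr => b _ do rewrite -Rmult_assoc (Rmult_comm _ (P x y)) Rmult_assoc.
rewrite -big_distrr /=; apply: Rmult_le_compat_l => //.
set U := _ + indic _.
apply: (Rle_trans _ (\sum_(b : {ffun I -> B}) ((\prod_j wB (b j)) * U +
  \sum_m (\prod_j wB (b j)) * indic (b m = b (E x)) * (indic (m <> E x) * indic (decodable (C m) y))))).
  apply: sumR_le => b.
  have -> : \sum_m (\prod_j wB (b j)) * indic (b m = b (E x)) *
      (indic (m <> E x) * indic (decodable (C m) y)) =
    (\prod_j wB (b j)) * \sum_m indic (m <> E x) * indic (b m = b (E x)) * indic (decodable (C m) y).
    by rewrite big_distrr /=; apply: eq_bigr => m _; ring.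
  rewrite -Rmult_plus_distr_l; apply: Rmult_le_compat_l; first exact: prodR_ge0.
  exact: err_pointwise.
rewrite big_split /= -big_distrl /= (sum_prodR1 _ wB1) Rmult_1_l.
apply: Rplus_le_compat_l; rewrite exchange_big /= big_distrr /=; apply: sumR_le => m.
rewrite -big_distrl /=.
case: (classic (m = E x)) => [e|ne].
  rewrite (@indic0 (m <> E x)) // Rmult_0_l Rmult_0_r.
  by apply: Rmult_le_pos; [left; exact: Rinv_0_lt_compat|exact: indic_ge0].
rewrite (sum_prodR_collision wB1 ne) (indic1 ne) Rmult_1_l /wB sumR_const.
apply: Rmult_le_compat_r; first exact: indic_ge0.
by rewrite -Rmult_assoc Rinv_r ?Rmult_1_l; [exact: Rle_refl|apply: Rgt_not_eq].
Qed.

Lemma mean_uncovered x :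
  \sum_(C : {ffun I -> V}) (\prod_j PV (C j)) * uncovered C x = (1 - mass x) ^ M.+1.
Proof.
have -> : 1 - mass x = \sum_v PV v * indic (~ encodable x v).
  rewrite /mass -sum_outV.
  rewrite [RHS](eq_bigr (fun v => PV v + - (PV v * indic (encodable x v)))).
    by rewrite big_split /= sumR_opp.
  by move=> v _; rewrite indic_not; ring.
rewrite -prodR_const -(sum_prodR (fun _ v => PV v * indic (~ encodable x v))).
apply: eq_bigr => C _; rewrite big_split /=; congr (_ * _); rewrite /uncovered.
case: (classic (forall m, ~ encodable x (C m))) => h.
  by rewrite indic1 // big1 // => m _; rewrite indic1.
rewrite indic0 //; case/not_all_not_ex: h => m h.
by rewrite (bigD1 m) //= indic0 ?Rmult_0_l // => /(_ h).
Qed.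

Lemma mean_load :
  \sum_(C : {ffun I -> V}) (\prod_j PV (C j)) * load C <= INR M.+1 * exp (- d).
Proof.
have D y : PY y * \sum_v PV v * indic (decodable v y) <= exp (- d) * PY y.
  rewrite -[X in _ <= _ * X]sum_outVY_V !big_distrr /=; apply: sumR_le => v.
  have o0 := outVY_ge0 v y; have e0 := exp_pos (- d).
  case: (classic (decodable v y)) => h; last by rewrite (indic0 h); nra.
  rewrite (indic1 h); have : exp d * exp (- d) = 1 by rewrite -exp_plus Rplus_opp_r exp_0.
  have := Rmult_le_compat_l _ _ _ (Rlt_le _ _ e0) h => h' e; apply: Rle_trans h'.
  have -> : exp (- d) * (exp d * PV v * PY y) = exp d * exp (- d) * (PV v * PY y) by ring.
  by rewrite e; lra.
have -> : INR M.+1 * exp (- d) = \sum_y INR M.+1 * (exp (- d) * PY y).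
  by rewrite -!big_distrr /= sum_pY Rmult_1_r.
under [X in X <= _]eq_bigr => C _ do rewrite /load exchange_big /= big_distrr /=.
rewrite exchange_big /=; apply: sumR_le => y.
apply: Rle_trans _ (Rmult_le_compat_l _ _ _ (pos_INR M.+1) (D y)).
right; have e := @sumR_const I; rewrite card_ord in e.
rewrite -e {e}.
under [LHS]eq_bigr => C _ do rewrite -big_distrl /= big_distrr /= big_distrr /=.
rewrite exchange_big /=; apply: eq_bigr => m _.
under [LHS]eq_bigr => C _ do rewrite -Rmult_assoc (Rmult_comm _ (\sum_x P x y)) Rmult_assoc.
by rewrite -big_distrr /= (sum_prodR_coord sum_outV m (fun v => indic (decodable v y))).
Qed.

(** A value of positive [Q x v] leaves [encodable] either by the ratio test against [exp c] or by a
    large [miss]. The second case is bounded by Markov's inequality at level [s], whence the factor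
    [/ s]. *)
Lemma mean_escape :
  \sum_x PX x * (1 - \sum_v Q x v * indic (encodable x v)) <=
  \sum_x \sum_v PX x * Q x v * indic (exp c * PV v < Q x v)
  + / s * \sum_v \sum_y PVY v y * indic (PVY v y < exp d * PV v * PY y).
Proof.
have is0 : 0 < / s by exact: Rinv_0_lt_compat.
have -> : \sum_v \sum_y PVY v y * indic (PVY v y < exp d * PV v * PY y) =
  \sum_x \sum_v Q x v * miss x v.
  rewrite [RHS]exchange_big /=; apply: eq_bigr => v _.
  rewrite /miss; under [RHS]eq_bigr => x _ do rewrite big_distrr /=.
  rewrite [RHS]exchange_big /=; apply: eq_bigr => y _.
  rewrite /PVY /outVY big_distrl /=; apply: eq_bigr => x _.
  rewrite (_ : indic (_ < _) = indic (~ decodable v y)); first by ring.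
  apply: Rle_antisym; apply: indic_le; rewrite /decodable /PVY /outVY => h; last exact: Rnot_le_lt.
  by apply: Rlt_not_le.
rewrite big_distrr /= -big_split /=; apply: sumR_le => x.
rewrite -{1}(Q1 x) big_distrr /= -big_split /=.
rewrite (_ : _ - _ = \sum_v Q x v * indic (~ encodable x v)); last first.
  rewrite [RHS](eq_bigr (fun v => Q x v + - (Q x v * indic (encodable x v)))).
    by rewrite big_split /= sumR_opp.
  by move=> v _; rewrite indic_not; ring.
rewrite big_distrr /=; apply: sumR_le => v.
have px := pX_ge0 x; have q0 := Q0 x v.
have m0 : 0 <= miss x v.
  by apply: sumR_ge0 => y; apply: Rmult_le_pos => //; exact: indic_ge0.
have r0 : 0 <= / s * (Q x v * miss x v).
  by apply: Rmult_le_pos; [lra|exact: Rmult_le_pos].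
have r1 : 0 <= PX x * Q x v * indic (exp c * PV v < Q x v).
  by apply: Rmult_le_pos; [exact: Rmult_le_pos|exact: indic_ge0].
case: (classic (encodable x v)) => h.
  by rewrite (@indic0 (~ encodable x v)) // !Rmult_0_r; lra.
rewrite (indic1 h) Rmult_1_r.
case: q0 => [q0|<-]; last by lra.
case: (Rlt_le_dec (exp c * PV v) (Q x v)) => h1.
  by rewrite (indic1 h1); lra.
case: (Rle_lt_dec (miss x v) (s * PX x)) => h2; first by case: h.
suff : PX x * Q x v <= / s * (Q x v * miss x v) by lra.
rewrite -[X in X <= _](_ : / s * (Q x v * (s * PX x)) = _); last by field; lra.
by apply: Rmult_le_compat_l; [lra|apply: Rmult_le_compat_l; lra].
Qed.

(** The terms are, in order: an undecodable choice, a failure of the [M.+1] codewords to cover, a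
    confusion inside a bin, and the tails of the two information densities. *)
Theorem oneshot_coding : exists (enc : X -> B) (dec : B -> Y -> V),
  \sum_x \sum_y P x y * indic (~ 0 < Q x (dec (enc x) y)) <=
  s + exp (- (INR M.+1 * exp (- c))) + INR M.+1 / INR #|B| * exp (- d)
  + \sum_x \sum_v PX x * Q x v * indic (exp c * PV v < Q x v)
  + / s * \sum_v \sum_y PVY v y * indic (PVY v y < exp d * PV v * PY y).
Proof.
pose bound := s + exp (- (INR M.+1 * exp (- c))) + INR M.+1 / INR #|B| * exp (- d)
  + \sum_x \sum_v PX x * Q x v * indic (exp c * PV v < Q x v)
  + / s * \sum_v \sum_y PVY v y * indic (PVY v y < exp d * PV v * PY y).
have [C hC] : exists C, \sum_x PX x * uncovered C x + s + / INR #|B| * load C <= bound.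
  apply: (exists_le_mean (w := fun C : {ffun I -> V} => \prod_j PV (C j))) => [C||].
  - by apply: prodR_ge0 => j; exact: outV_ge0.
  - exact: (sum_prodR1 _ sum_outV).
  have -> : \sum_(C : {ffun I -> V}) (\prod_j PV (C j)) *
      (\sum_x PX x * uncovered C x + s + / INR #|B| * load C) =
    \sum_x \sum_(C : {ffun I -> V}) PX x * ((\prod_j PV (C j)) * uncovered C x) + s
    + / INR #|B| * \sum_(C : {ffun I -> V}) (\prod_j PV (C j)) * load C.
    rewrite (eq_bigr (fun C : {ffun I -> V} => \sum_x PX x * ((\prod_j PV (C j)) * uncovered C x) +
      (\prod_j PV (C j)) * s + / INR #|B| * ((\prod_j PV (C j)) * load C))); last first.
      move=> C _; rewrite !Rmult_plus_distr_l big_distrr /=; congr (_ + _ + _); last by ring.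
      by apply: eq_bigr => x _; ring.
    rewrite !big_split /= -big_distrl /= (sum_prodR1 _ sum_outV) Rmult_1_l -big_distrr /=.
    by rewrite exchange_big.
  have load_le := Rmult_le_compat_l _ _ _ (Rlt_le _ _ (Rinv_0_lt_compat _ cardB)) mean_load.
  have esc := mean_escape.
  suff : \sum_x \sum_(C : {ffun I -> V}) PX x * ((\prod_j PV (C j)) * uncovered C x) <=
    \sum_x PX x * (1 - \sum_v Q x v * indic (encodable x v)) + exp (- (INR M.+1 * exp (- c))).
    by move: load_le esc; rewrite /bound /Rdiv; lra.
  set t := exp (- _).
  have -> : \sum_x PX x * (1 - \sum_v Q x v * indic (encodable x v)) + t =
    \sum_x (PX x * (1 - \sum_v Q x v * indic (encodable x v)) + PX x * t).
    by rewrite big_split /= -big_distrl /= sum_pX Rmult_1_l.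
  apply: sumR_le => x; rewrite -Rmult_plus_distr_l.
  have -> : \sum_(C : {ffun I -> V}) PX x * ((\prod_j PV (C j)) * uncovered C x) =
    PX x * (1 - mass x) ^ M.+1 by rewrite -mean_uncovered big_distrr.
  by apply: Rmult_le_compat_l; [exact: pX_ge0|exact: uncoverable_le].
have [b hb] : exists b, err C b <= bound.
  apply: (exists_le_mean (w := fun b : {ffun I -> B} => \prod_j wB (b j))) => [b||].
  - exact: prodR_ge0.
  - exact: (sum_prodR1 _ wB1).
  exact: Rle_trans (mean_err_bins C) hC.
by exists (fun x => b (enc C x)), (dec C b).
Qed.
End OneShot.

(** * Information quantities of a test channel *)

Definition channel (X V : finType) (q : X -> V -> R) : Prop :=
  (forall x v, 0 <= q x v) /\ (forall x, \sum_v q x v = 1).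

Section Information.
Variables (X Y V : finType) (p : X -> Y -> R) (q : X -> V -> R).

(** In nats, [mutXV] is I(V;X), [mutVY] is I(V;Y) and [cmi] is I(V;X|Y), whose ratio is
    P(v|x)/P(v|y). Terms of weight zero vanish whatever value [ln] takes there. *)
Definition mutXV : R := \sum_x \sum_v pX p x * q x v * ln (q x v / outV p q v).
Definition mutVY : R :=
  \sum_v \sum_y outVY p q v y * ln (outVY p q v y / (outV p q v * pY p y)).
Definition cmi : R :=
  \sum_v \sum_x \sum_y p x y * q x v * ln (q x v * pY p y / outVY p q v y).

Hypothesis hp : is_pmf p.
Hypothesis hq : channel q.

Let p0 := hp.1.
Let p1 := hp.2.
Let q0 := hq.1.
Let q1 := hq.2.

Lemma joint_gt0 x y v : 0 < p x y -> 0 < q x v ->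
  [/\ 0 < pX p x, 0 < pY p y, 0 < outV p q v & 0 < outVY p q v y].
Proof.
move=> pp qq.
have px : 0 < pX p x by apply: Rlt_le_trans pp _; exact: (term_le_sumR y (p0 x)).
split=> //.
- by apply: Rlt_le_trans pp _; exact: (term_le_sumR x (fun x => p0 x y)).
- apply: Rlt_le_trans (Rmult_lt_0_compat _ _ px qq) _.
  apply: (term_le_sumR (F := fun x => pX p x * q x v)) => x'.
  by apply: Rmult_le_pos => //; apply: sumR_ge0.
- apply: Rlt_le_trans (Rmult_lt_0_compat _ _ pp qq) _.
  by apply: (term_le_sumR (F := fun x => p x y * q x v)) => x'; apply: Rmult_le_pos.
Qed.

Lemma ln_div (a b : R) : 0 < a -> 0 < b -> ln (a / b) = ln a - ln b.
Proof. by move=> a0 b0; rewrite /Rdiv ln_mult ?ln_Rinv //; exact: Rinv_0_lt_compat. Qed.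

Lemma cmi_mutual_info : cmi = mutXV - mutVY.
Proof.
have -> : mutXV = \sum_v \sum_x \sum_y p x y * q x v * ln (q x v / outV p q v).
  rewrite /mutXV exchange_big; apply: eq_bigr => v _; apply: eq_bigr => x _.
  by rewrite /pX !big_distrl.
have -> : mutVY = \sum_v \sum_x \sum_y p x y * q x v *
    ln (outVY p q v y / (outV p q v * pY p y)).
  rewrite /mutVY; apply: eq_bigr => v _; rewrite exchange_big; apply: eq_bigr => y _.
  by rewrite {1}/outVY big_distrl.
rewrite /Rminus -sumR_opp -big_split; apply: eq_bigr => v _ /=.
rewrite -sumR_opp -big_split; apply: eq_bigr => x _ /=.
rewrite -sumR_opp -big_split; apply: eq_bigr => y _ /=.
case: (p0 x y) => [pp|<-]; last by ring.
case: (q0 x v) => [qq|<-]; last by ring.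
have [_ y0 v0 vy0] := joint_gt0 pp qq.
by rewrite !ln_div ?ln_mult //; [ring|exact: Rmult_lt_0_compat..].
Qed.

(** From ln t <= t - 1 at t = b / a. Summed over two laws it says that a divergence is
    nonnegative. *)
Lemma gibbs_term (a b : R) : 0 <= a -> 0 <= b -> (0 < a -> 0 < b) ->
  a - b <= a * ln (a / b).
Proof.
move=> [a0|<-] b0 h; last by lra.
have {h} b1 := h a0; have ba : 0 < b / a by exact: Rdiv_lt_0_compat.
have := exp_ineq1_le (ln (b / a)); rewrite exp_ln // => e.
have -> : ln (a / b) = - ln (b / a) by rewrite !ln_div //; lra.
have : a * (1 + ln (b / a)) <= a * (b / a) by apply: Rmult_le_compat_l; lra.
have -> : a * (b / a) = b by field; lra.
lra.
Qed.

Lemma mutXV_ge0 : 0 <= mutXV.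
Proof.
have s1 : \sum_x \sum_v pX p x * q x v = 1.
  by rewrite -p1; apply: eq_bigr => x _; rewrite -big_distrr /= q1 Rmult_1_r.
have s2 : \sum_x \sum_v pX p x * outV p q v = 1.
  rewrite -p1; apply: eq_bigr => x _.
  by rewrite -big_distrr /= sum_outV // Rmult_1_r.
have -> : 0 = \sum_x \sum_v (pX p x * q x v + - (pX p x * outV p q v)).
  rewrite (eq_bigr (fun x => \sum_v pX p x * q x v + - \sum_v pX p x * outV p q v)).
    by rewrite big_split /= sumR_opp s1 s2; lra.
  by move=> x _; rewrite big_split /= sumR_opp.
apply: sumR_le => x; apply: sumR_le => v.
have [px|<-] : 0 <= pX p x by apply: sumR_ge0.
  rewrite Rmult_assoc -Ropp_mult_distr_r_reverse -Rmult_plus_distr_l.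
  apply: Rmult_le_compat_l; first by lra.
  apply: gibbs_term => //; first by apply: outV_ge0.
  move=> qq; apply: Rlt_le_trans (Rmult_lt_0_compat _ _ px qq) _.
  apply: (term_le_sumR (F := fun x => pX p x * q x v)) => x'.
  by apply: Rmult_le_pos => //; apply: sumR_ge0.
by right; ring.
Qed.

End Information.

(** * Product sources and product test channels *)

Section Memoryless.
Variables (X Y V : finType) (p : X -> Y -> R) (q : X -> V -> R) (n : nat).

Definition seqQ (xs : {ffun 'I_n -> X}) (vs : {ffun 'I_n -> V}) : R :=
  \prod_i q (xs i) (vs i).

Lemma pX_seq xs : pX (@seq_prob X Y p n) xs = \prod_i pX p (xs i).
Proof. exact: (sum_prodR (fun i y => p (xs i) y)). Qed.

Lemma pY_seq ys : pY (@seq_prob X Y p n) ys = \prod_i pY p (ys i).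
Proof. exact: (sum_prodR (fun i x => p x (ys i))). Qed.

Lemma outV_seq vs : outV (@seq_prob X Y p n) seqQ vs = \prod_i outV p q (vs i).
Proof.
rewrite -(sum_prodR (fun i x => pX p x * q x (vs i))).
by apply: eq_bigr => xs _; rewrite pX_seq big_split.
Qed.

Lemma outVY_seq vs ys :
  outVY (@seq_prob X Y p n) seqQ vs ys = \prod_i outVY p q (vs i) (ys i).
Proof.
rewrite -(sum_prodR (fun i x => p x (ys i) * q x (vs i))).
by apply: eq_bigr => xs _; rewrite big_split.
Qed.

Lemma seq_prob_pmf : is_pmf p -> is_pmf (@seq_prob X Y p n).
Proof.
move=> [p0 p1]; split=> [xs ys|]; first by apply: prodR_ge0.
rewrite (eq_bigr (fun xs : {ffun 'I_n -> X} => \prod_i pX p (xs i))).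
  exact: (sum_prodR1 _ (w := pX p)).
by move=> xs _; exact: pX_seq.
Qed.

Lemma seqQ_channel : channel q -> channel seqQ.
Proof.
move=> [q0 q1]; split=> [xs vs|xs]; first by apply: prodR_ge0.
by rewrite (sum_prodR (fun i v => q (xs i) v)) big1.
Qed.

End Memoryless.

(** The event has to force a nonnegative sum only where all weights are positive. When [g] is a
    logarithm, its arguments are then positive. *)
Lemma pair_chernoff (A B : finType) (w g : A -> B -> R) :
  (forall a b, 0 <= w a b) -> \sum_a \sum_b w a b = 1 ->
  \sum_a \sum_b w a b * g a b < 0 ->
  exists rho, 0 <= rho < 1 /\
  forall n (E : {ffun 'I_n -> A} -> {ffun 'I_n -> B} -> Prop),
    (forall (a : {ffun 'I_n -> A}) (b : {ffun 'I_n -> B}),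
      (forall i, 0 < w (a i) (b i)) -> E a b -> 0 <= \sum_i g (a i) (b i)) ->
    \sum_(a : {ffun 'I_n -> A}) \sum_(b : {ffun 'I_n -> B}) (\prod_i w (a i) (b i)) * indic (E a b) <= rho ^ n.
Proof.
move=> w0 w1 wg.
have [|||rho [hr h]] := @chernoff (A * B)%type (fun u => w u.1 u.2) (fun u => g u.1 u.2).
- by [].
- by rewrite -(pair_bigA _ w).
- by rewrite -(pair_bigA _ (fun a b => w a b * g a b)).
exists rho; split=> // n E hE; apply: Rle_trans (h n).
rewrite sum_ffun_pair; apply: sumR_le => z /=.
rewrite (eq_bigr (fun i => w (z i).1 (z i).2)); last by move=> i _; rewrite !ffunE.
have W0 : 0 <= \prod_i w (z i).1 (z i).2 by apply: prodR_ge0.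
case: W0 => [W0|<-]; last by lra.
apply: Rmult_le_compat_l; first exact: Rlt_le.
apply: indic_le => /hE; under eq_bigr => i _ do rewrite !ffunE; apply=> i.
by rewrite !ffunE; apply: (prodR_gt0P (F := fun i => w (z i).1 (z i).2) i).
Qed.

(** * Achievability *)

Section Tails.
Variables (X Y V : finType) (p : X -> Y -> R) (q : X -> V -> R).
Hypothesis hp : is_pmf p.
Hypothesis hq : channel q.
Variable delta : R.
Hypothesis d0 : 0 < delta.

Let p0 := hp.1.
Let q0 := hq.1.

Lemma sum_ord_const (n : nat) (x : R) : \sum_(i < n) x = INR n * x.
Proof. by have := sumR_const 'I_n x; rewrite card_ord. Qed.

(** The information density, shifted by its mean plus [delta], has mean [- delta]. Taking logarithms
    in the event gives a nonnegative sum of such terms. [tail_VY] bounds the lower tail in the same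
    way, with signs reversed. *)
Lemma tail_XV : exists rho, 0 <= rho < 1 /\ forall n,
  \sum_xs \sum_vs pX (@seq_prob X Y p n) xs * seqQ q xs vs *
    indic (exp (INR n * (mutXV p q + delta)) * outV (@seq_prob X Y p n) (@seqQ X V q n) vs
           < seqQ q xs vs) <= rho ^ n.
Proof.
have px0 x : 0 <= pX p x by apply: sumR_ge0.
have s1 : \sum_x \sum_v pX p x * q x v = 1.
  by rewrite -hp.2; apply: eq_bigr => x _; rewrite -big_distrr /= hq.2 Rmult_1_r.
have [||| rho [hr h]] := @pair_chernoff X V (fun x v => pX p x * q x v)
  (fun x v => ln (q x v / outV p q v) - (mutXV p q + delta)).
- by move=> x v; apply: Rmult_le_pos.
- by [].
- rewrite (_ : \sum_x _ = mutXV p q - 1 * (mutXV p q + delta)); first by lra.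
  rewrite -{1}s1 big_distrl /= /Rminus -sumR_opp -big_split /=; apply: eq_bigr => x _.
  by rewrite big_distrl /= -sumR_opp -big_split /=; apply: eq_bigr => v _; ring.
exists rho; split=> // n.
apply: (Rle_trans _ _ _ _ (h n (fun xs vs => exp (INR n * (mutXV p q + delta)) *
  outV (@seq_prob X Y p n) (@seqQ X V q n) vs < seqQ q xs vs) _)).
  right; apply: eq_bigr => xs _; apply: eq_bigr => vs _.
  by rewrite pX_seq /seqQ big_split.
move=> xs vs pos; rewrite outV_seq /seqQ => lt.
have qpos i : 0 < q (xs i) (vs i).
  by case: (q0 (xs i) (vs i)) => // e; have := pos i; rewrite -e Rmult_0_r; lra.
have opos i : 0 < outV p q (vs i).
  apply: Rlt_le_trans (pos i) _.
  by apply: (term_le_sumR (F := fun x => pX p x * q x (vs i))) => x; apply: Rmult_le_pos.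
have {}lt := ln_increasing _ _ (Rmult_lt_0_compat _ _ (exp_pos _) (prodR_gt0 opos)) lt.
rewrite ln_mult ?ln_exp ?ln_prodR // in lt; try exact: exp_pos; try exact: prodR_gt0.
rewrite (eq_bigr (fun i => ln (q (xs i) (vs i)) + - ln (outV p q (vs i)) + - (mutXV p q + delta))).
  by rewrite !sumR_add sumR_opp sum_ord_const; lra.
by move=> i _; rewrite ln_div.
Qed.

Lemma tail_VY : exists rho, 0 <= rho < 1 /\ forall n,
  \sum_vs \sum_ys outVY (@seq_prob X Y p n) (@seqQ X V q n) vs ys *
    indic (outVY (@seq_prob X Y p n) (@seqQ X V q n) vs ys <
      exp (INR n * (mutVY p q - delta)) * outV (@seq_prob X Y p n) (@seqQ X V q n) vs *
      pY (@seq_prob X Y p n) ys) <= rho ^ n.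
Proof.
have px0 x : 0 <= pX p x by apply: sumR_ge0.
have o0 v y : 0 <= outVY p q v y by apply: outVY_ge0.
have s1 : \sum_v \sum_y outVY p q v y = 1.
  rewrite exchange_big -(sum_pY hp.2) /=; apply: eq_bigr => y _; exact: sum_outVY_V hq.2 _.
have [||| rho [hr h]] := @pair_chernoff V Y (outVY p q)
  (fun v y => - ln (outVY p q v y / (outV p q v * pY p y)) + (mutVY p q - delta)).
- by [].
- by [].
- rewrite (_ : \sum_v _ = - mutVY p q + 1 * (mutVY p q - delta)); first by lra.
  rewrite -{1}s1 big_distrl /= -sumR_opp -big_split /=; apply: eq_bigr => v _.
  by rewrite big_distrl /= -sumR_opp -big_split /=; apply: eq_bigr => y _; ring.
exists rho; split=> // n.
apply: (Rle_trans _ _ _ _ (h n (fun vs ys =>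
  outVY (@seq_prob X Y p n) (@seqQ X V q n) vs ys <
      exp (INR n * (mutVY p q - delta)) * outV (@seq_prob X Y p n) (@seqQ X V q n) vs *
      pY (@seq_prob X Y p n) ys) _)).
  right; apply: eq_bigr => vs _; apply: eq_bigr => ys _.
  by rewrite outVY_seq.
move=> vs ys pos; rewrite outVY_seq outV_seq pY_seq => lt.
have ypos i : 0 < pY p (ys i).
  apply: Rlt_le_trans (pos i) _; rewrite -(sum_outVY_V p hq.2).
  exact: (term_le_sumR (F := fun v => outVY p q v (ys i))).
have opos i : 0 < outV p q (vs i).
  apply: Rlt_le_trans (pos i) _; rewrite -sum_outVY_Y.
  exact: (term_le_sumR (F := fun y => outVY p q (vs i) y)).
have {}lt := ln_increasing _ _ (prodR_gt0 pos) lt.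
rewrite !ln_mult ?ln_exp ?ln_prodR // in lt; try exact: exp_pos; try exact: prodR_gt0; last first.
  by apply: Rmult_lt_0_compat; [exact: exp_pos|exact: prodR_gt0].
move: (mutVY p q - delta) lt => k lt.
rewrite (eq_bigr (fun i => - ln (outVY p q (vs i) (ys i)) +
   ln (outV p q (vs i)) + ln (pY p (ys i)) + k)).
  rewrite !sumR_add sumR_opp sum_ord_const.
  have lin (a b c d : R) : a < d + b + c -> 0 <= - a + b + c + d by lra.
  exact: lin lt.
by move=> i _; rewrite ln_div ?ln_mult //; [ring|exact: Rmult_lt_0_compat].
Qed.

Lemma entropyY_nats : entropyY p * ln 2 = \sum_y - (pY p y * ln (pY p y)).
Proof.
have l2 : 0 < ln 2 by have := ln_lt_2; lra.
rewrite /entropyY -sumR_opp big_distrl /=; apply: eq_bigr => y _.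
case: Rlt_dec => [h|h] /=; first by rewrite /log2; field; lra.
have [//|<-] : 0 <= pY p y by apply: pY_ge0.
by ring.
Qed.

Lemma entropyY_ge0 : 0 <= entropyY p * ln 2.
Proof.
rewrite entropyY_nats; apply: sumR_ge0 => y.
have y0 : 0 <= pY p y by apply: pY_ge0.
case: y0 => [y0|<-]; last by lra.
have y1 : pY p y <= 1.
  rewrite -(sum_pY hp.2); apply: term_le_sumR => y'; exact: pY_ge0.
have : ln (pY p y) <= 0.
  by case: y1 => [lt|->]; [left; rewrite -ln_1; exact: ln_increasing|rewrite ln_1; lra].
nra.
Qed.

(** The sequences that Y describes exactly. A one-sided condition is enough: a lower bound on each
    probability bounds their number, since the total is at most 1. *)
Definition likelyY (n : nat) : {set {ffun 'I_n -> Y}} :=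
  [set ys | if Rle_dec (exp (- (INR n * (entropyY p * ln 2 + delta)))) (pY (@seq_prob X Y p n) ys)
            then true else false].

Lemma in_likelyY n (ys : {ffun 'I_n -> Y}) :
  ys \in likelyY n <->
  exp (- (INR n * (entropyY p * ln 2 + delta))) <= pY (@seq_prob X Y p n) ys.
Proof. by rewrite inE; case: Rle_dec. Qed.

Lemma card_likelyY n : INR #|likelyY n| <= exp (INR n * (entropyY p * ln 2 + delta)).
Proof.
set t := INR n * _.
have P1 := sum_pY (seq_prob_pmf n hp).2.
have : INR #|likelyY n| * exp (- t) <= 1.
  rewrite -P1 (bigID (mem (likelyY n))) /=.
  apply: (Rle_trans _ (\sum_(ys in likelyY n) pY (@seq_prob X Y p n) ys)).
    have -> : INR #|likelyY n| * exp (- t) = \sum_(ys in likelyY n) exp (- t).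
      rewrite big_const; elim: #|_| => [|k IH]; first by rewrite /=; lra.
      by rewrite iterS -IH S_INR; ring.
    rewrite big_mkcond [X in _ <= X]big_mkcond /=; apply: sumR_le => ys.
    by case: ifP => [/in_likelyY //|_]; lra.
  have : 0 <= \sum_(ys | ys \notin likelyY n) pY (@seq_prob X Y p n) ys.
    by apply: sumR_ge0 => ys; apply: pY_ge0; exact: (seq_prob_pmf n hp).1.
  have lin (a b : R) : 0 <= b -> a <= a + b by lra.
  exact: lin.
have e0 := exp_pos t; have : exp t * exp (- t) = 1 by rewrite -exp_plus Rplus_opp_r exp_0.
by have := exp_pos (- t); nra.
Qed.

Lemma tail_Y : exists rho, 0 <= rho < 1 /\ forall n,
  \sum_(xs : {ffun 'I_n -> X}) \sum_(ys : {ffun 'I_n -> Y})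
    seq_prob p xs ys * indic (ys \notin likelyY n) <= rho ^ n.
Proof.
pose h := entropyY p * ln 2.
have [||| rho [hr hn]] := @pair_chernoff X Y p (fun x y => - ln (pY p y) - (h + delta)).
- exact: hp.1.
- exact: hp.2.
- have e1 : \sum_x \sum_y p x y * - ln (pY p y) = h.
    rewrite /h entropyY_nats exchange_big; apply: eq_bigr => y _.
    by rewrite -big_distrl /= -/(pY p y); ring.
  have e2 : \sum_x \sum_y p x y * - (h + delta) = - (h + delta).
    rewrite -[RHS]Rmult_1_l -hp.2 big_distrl /=.
    by apply: eq_bigr => x _; rewrite big_distrl.
  suff -> : \sum_x \sum_y p x y * (- ln (pY p y) - (h + delta)) =
    \sum_x \sum_y p x y * - ln (pY p y) + \sum_x \sum_y p x y * - (h + delta).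
    by rewrite e1 e2; lra.
  rewrite -sumR_add; apply: eq_bigr => x _.
  by rewrite -sumR_add; apply: eq_bigr => y _; ring.
exists rho; split=> // n; apply: (hn n (fun xs ys => ys \notin likelyY n)).
move=> xs ys pos /negP nl.
have ypos i : 0 < pY p (ys i).
  by apply: Rlt_le_trans (pos i) _; exact: (term_le_sumR (F := fun x => p x (ys i))).
have {nl} lt : pY (@seq_prob X Y p n) ys < exp (- (INR n * (h + delta))).
  by apply: Rnot_le_lt => le; apply: nl; apply/in_likelyY.
rewrite pY_seq in lt; have {}lt := ln_increasing _ _ (prodR_gt0 ypos) lt.
rewrite ln_exp ln_prodR // in lt.
by rewrite /Rminus sumR_add sumR_opp sum_ord_const; lra.
Qed.

End Tails.

Lemma msgs_le n r : INR (msgs n r) <= exp (INR n * r * ln 2).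
Proof.
rewrite /msgs /Rpower; set t := exp _; have t0 : 0 < t by exact: exp_pos.
have [h1 h2] := base_Int_part t.
have z : (0 <= Int_part t)%Z.
  suff : (-1 < Int_part t)%Z by lia.
  by apply: lt_IZR; lra.
by rewrite INR_IZR_INZ Z2Nat.id //; lra.
Qed.

(** The floor of a number that is at least 1 is at least half of it; [0 <= r] puts 2^(nr) in that
    range. *)
Lemma msgs_ge n r : 0 <= r -> exp (INR n * r * ln 2) / 2 <= INR (msgs n r).
Proof.
move=> r0; rewrite /msgs /Rpower; set t := exp _.
have l2 : 0 < ln 2 by have := ln_lt_2; lra.
have t1 : 1 <= t.
  have := exp_ineq1_le (INR n * r * ln 2); rewrite -/t.
  have : 0 <= INR n * r * ln 2.
    by apply: Rmult_le_pos; [apply: Rmult_le_pos => //; exact: pos_INR|lra].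
  lra.
have [h1 h2] := base_Int_part t.
have z : (1 <= Int_part t)%Z.
  suff : (0 < Int_part t)%Z by lia.
  by apply: lt_IZR; lra.
have z1 := IZR_le _ _ z.
rewrite INR_IZR_INZ Z2Nat.id; last by lia.
lra.
Qed.

Lemma pow_eventually_le (rho K e : R) : 0 <= rho < 1 -> 0 <= K -> 0 < e ->
  exists N : nat, forall n, (N <= n)%nat -> K * rho ^ n <= e.
Proof.
move=> [r0 r1] K0 e0.
have e1 : 0 < e / (K + 1) by apply: Rdiv_lt_0_compat; lra.
have [|N hN] := pow_lt_1_zero rho _ (e / (K + 1)) e1; first by rewrite Rabs_pos_eq.
exists N => n /leP /hN; have rn := pow_le rho n r0; rewrite Rabs_pos_eq // => h.
have -> : e = (K + 1) * (e / (K + 1)) by field; lra.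
by apply: Rmult_le_compat; lra.
Qed.

(** * From test channels to codes for the network *)

Section Codes.
Variables (X Y F : finType) (p : X -> Y -> R) (f : X -> Y -> F).
Hypothesis hp : is_pmf p.

Lemma pmf_inhabited : inhabited (X * Y).
Proof.
apply: NNPP => ni; have := hp.2; rewrite big1 => [|x _]; first by lra.
by apply: big1 => y _; case: ni; exact: (inhabits (x, y)).
Qed.

Lemma admissible_channel (q : X -> {set X} -> R) : admissible p f q -> channel q.
Proof. by case=> q0 [q1 _]. Qed.

(* Y forwards the index from [phi0] together with its own sequence, so that the
   decoder sees both parts of the index of X and the side information. *)
Lemma code_of_side_information (q : X -> {set X} -> R) (n : nat) (R0 RX RY : R)
  (enc : {ffun 'I_n -> X} -> 'I_(msgs n R0) * 'I_(msgs n RX))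
  (dec : 'I_(msgs n R0) * 'I_(msgs n RX) -> {ffun 'I_n -> Y} -> {ffun 'I_n -> {set X}})
  (T : {set {ffun 'I_n -> Y}}) :
  admissible p f q -> (msgs n R0 * #|T|.+1 <= msgs n RY)%nat ->
  exists phi0 phiX phiY psi, @code_error X Y F p f n R0 RX RY phi0 phiX phiY psi <=
    \sum_(xs : {ffun 'I_n -> X}) \sum_(ys : {ffun 'I_n -> Y})
      seq_prob p xs ys * indic (~ 0 < seqQ q xs (dec (enc xs) ys))
    + \sum_(xs : {ffun 'I_n -> X}) \sum_(ys : {ffun 'I_n -> Y})
      seq_prob p xs ys * indic (ys \notin T).
Proof.
move=> [q0 [q1 [qind qin]]] hT.
(* [None] is sent for every sequence outside [T]; it accounts for the successor in [#|T|.+1]. *)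
pose Z := ('I_(msgs n R0) * option {ys | ys \in T})%type.
have cZ : (#|{: Z}| <= msgs n RY)%nat.
  by rewrite card_prod card_ord card_option card_sig.
pose code (z : Z) : 'I_(msgs n RY) := widen_ord cZ (enum_rank z).
have codeI : injective code.
  by move=> z1 z2 /(congr1 val) /= /ord_inj /enum_rank_inj.
have [[x0 y0]] := pmf_inhabited.
(* Any letter of [v] compatible with [y] may be picked: independence of [v] makes all of them give
   the same value of [f] at [y]. *)
pose g (v : {set X}) y : F :=
  if [pick x | (x \in v) && (if Rlt_dec 0 (p x y) then true else false)] is Some x
  then f x y else f x0 y0.
pose phiY (ys : {ffun 'I_n -> Y}) b0 := code (b0, insub ys).
pose psi (bX : 'I_(msgs n RX)) (bY : 'I_(msgs n RY)) : {ffun 'I_n -> F} :=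
  if [pick z | code z == bY] is Some (b0, Some ys) then
    [ffun i => g (dec (b0, bX) (val ys) i) (val ys i)]
  else [ffun i => f x0 y0].
exists (fun xs => (enc xs).1), (fun xs => (enc xs).2), phiY, psi.
rewrite /code_error -sumR_add; apply: sumR_le => xs.
rewrite -sumR_add; apply: sumR_le => ys.
have W0 : 0 <= seq_prob p xs ys by apply: prodR_ge0 => i; exact: hp.1.
set A := indic (~ _); set B := indic (_ \notin _).
have A0 : 0 <= A by exact: indic_ge0.
have B0 : 0 <= B by exact: indic_ge0.
case: ifP => [_|/eqP ne].
  by apply: Rplus_le_le_0_compat; exact: Rmult_le_pos.
case: W0 => [W0|<-]; last by lra.
have pos i : 0 < p (xs i) (ys i).
  by apply: (prodR_gt0P (F := fun i => p (xs i) (ys i)) i) => // j; exact: hp.1.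
case: (boolP (ys \in T)) => [yT|nT]; last first.
  have -> : B = 1 by exact: indic1.
  by have := Rmult_le_pos _ _ (Rlt_le _ _ W0) A0; lra.
case: (classic (0 < seqQ q xs (dec (enc xs) ys))) => [Q0|nQ]; last first.
  have -> : A = 1 by exact: indic1.
  by have := Rmult_le_pos _ _ (Rlt_le _ _ W0) B0; lra.
case: ne; rewrite /psi /phiY; case: pickP => [z /eqP /codeI ->|/(_ ((enc xs).1, insub ys))]; last first.
  by rewrite eqxx.
rewrite insubT /=; apply/ffunP => i; rewrite !ffunE -surjective_pairing.
set v := dec _ _ i.
have qv : 0 < q (xs i) v.
  by apply: (prodR_gt0P (F := fun i => q (xs i) (dec (enc xs) ys i)) i).
have pq : 0 < pX p (xs i) * q (xs i) v.
  apply: Rmult_lt_0_compat => //; apply: Rlt_le_trans (pos i) _.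
  by apply: (term_le_sumR (F := p (xs i))) => y; exact: hp.1.
have iv := qind _ _ pq; have xv := qin _ _ pq.
rewrite /g; case: pickP => [x /andP[xin]|/(_ (xs i))]; last first.
  by rewrite xv; case: Rlt_dec => // /(_ (pos i)).
case: Rlt_dec => // px _; apply: NNPP => nf; apply: (iv x (xs i)) => //.
by exists (ys i); split=> //; exact: Rmult_lt_0_compat.
Qed.

Lemma achievable_of_channel (q : X -> {set X} -> R) (R0 RX RY : R) :
  admissible p f q -> 0 <= R0 -> 0 <= RX -> R0 + entropyY p < RY ->
  cmi p q < (R0 + RX) * ln 2 -> achievable p f R0 RX RY.
Proof.
move=> hq r0 rx ry hI eps e0.
have l2 : 0 < ln 2 by have := ln_lt_2; lra.
have hc := admissible_channel hq.
pose J := mutXV p q; pose K := mutVY p q; pose H := entropyY p * ln 2.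
have JK : cmi p q = J - K by exact: cmi_mutual_info.
have J0 : 0 <= J by exact: mutXV_ge0.
have H0 : 0 <= H by exact: entropyY_ge0.
(* The rate margin is cut in four. With exponents per letter [J + 2 * de] for the codebook, [J + de]
   for [c], [K - de] for [d] and [J - K + 4 * de] for the bins, both covering and confusion keep a
   margin of exactly [de]. *)
pose de := ((R0 + RX) * ln 2 - cmi p q) / 4.
have de0 : 0 < de by rewrite /de; lra.
have deE : (R0 + RX) * ln 2 = J - K + 4 * de by rewrite /de JK; lra.
(* One half of Y's margin enlarges the likely set. The other absorbs the factor 4 in [h4]: 2 from
   the floor in [msgs] and 2 from the extra symbol in [#|T|.+1]. *)
pose dy := (RY - R0 - entropyY p) * ln 2 / 2.
have dy0 : 0 < dy by rewrite /dy; have : 0 < (RY - R0 - entropyY p) * ln 2 by [apply: Rmult_lt_0_compat; lra]; lra.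
have dyE : RY * ln 2 = R0 * ln 2 + H + 2 * dy by rewrite /dy /H; lra.
have [r1 [hr1 t1]] := tail_XV hp hc de0.
have [r2 [hr2 t2]] := tail_VY hp hc de0.
have [r3 [hr3 t3]] := tail_Y hp dy0.
have em t : 0 < t -> 0 <= exp (- t) < 1.
  by move=> t0; split; [left; exact: exp_pos|rewrite -exp_0; apply: exp_increasing; lra].
have epow t n : exp (- t) ^ n = exp (- (INR n * t)).
  elim: n => [|n IH]; first by rewrite /= Rmult_0_l Ropp_0 exp_0.
  by rewrite S_INR /= IH -exp_plus; congr exp; ring.
(* Five shares: [s] itself, covering and confusion together, and three tails. Below, 9 = 1 + 8,
   where 8 comes from at most [2 * exp a] codewords and at least a quarter of the nominal number of
   bins. As [s] is fixed, [/ s] is a constant in front of [r2 ^ n]. *)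
pose s := eps / 5.
have s0 : 0 < s by rewrite /s; lra.
have [N0 h0] := pow_eventually_le (em _ de0) (K := 9) ltac:(lra) s0.
have [N1 h1] := pow_eventually_le hr1 (K := 1) ltac:(lra) s0.
have [N2 h2] := pow_eventually_le hr2 (K := / s) (Rlt_le _ _ (Rinv_0_lt_compat _ s0)) s0.
have [N3 h3] := pow_eventually_le hr3 (K := 1) ltac:(lra) s0.
have [N4 h4] := pow_eventually_le (em _ dy0) (K := 4) (e := 1) ltac:(lra) ltac:(lra).
exists (N0 + (N1 + (N2 + (N3 + N4))))%nat => n hn.
have {h0 hn} [h0 hn] : 9 * exp (- de) ^ n <= s /\ (N1 + (N2 + (N3 + N4)) <= n)%nat.
  by split; [apply: h0; apply: leq_trans hn; exact: leq_addr|apply: leq_trans hn; exact: leq_addl].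
have {h1 hn} [h1 hn] : 1 * r1 ^ n <= s /\ (N2 + (N3 + N4) <= n)%nat.
  by split; [apply: h1; apply: leq_trans hn; exact: leq_addr|apply: leq_trans hn; exact: leq_addl].
have {h2 hn} [h2 hn] : / s * r2 ^ n <= s /\ (N3 + N4 <= n)%nat.
  by split; [apply: h2; apply: leq_trans hn; exact: leq_addr|apply: leq_trans hn; exact: leq_addl].
have {h3 hn} [h3 hn] : 1 * r3 ^ n <= s /\ (N4 <= n)%nat.
  by split; [apply: h3; apply: leq_trans hn; exact: leq_addr|apply: leq_trans hn; exact: leq_addl].
have {hn h4} h4 := h4 n hn.
rewrite !epow in h0 h4.
have n0 := pos_INR n.
set B := ('I_(msgs n R0) * 'I_(msgs n RX))%type.
have cB : exp (INR n * (J - K + 4 * de)) / 4 <= INR #|{: B}|.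
  rewrite card_prod !card_ord mult_INR -deE.
  have -> : exp (INR n * ((R0 + RX) * ln 2)) / 4 =
    exp (INR n * R0 * ln 2) / 2 * (exp (INR n * RX * ln 2) / 2).
    by rewrite (_ : INR n * ((R0 + RX) * ln 2) = INR n * R0 * ln 2 + INR n * RX * ln 2) ?exp_plus; [field|ring].
  apply: Rmult_le_compat; try exact: msgs_ge.
  - by have := exp_pos (INR n * R0 * ln 2); lra.
  - by have := exp_pos (INR n * RX * ln 2); lra.
have cB0 : 0 < INR #|{: B}| by have := exp_pos (INR n * (J - K + 4 * de)); lra.
have B0 : (0 < #|{: B}|)%nat.
  by case: #|{: B}| cB0 => //=; lra.
pose a := INR n * (J + 2 * de).
have a0 : 0 <= a by apply: Rmult_le_pos; lra.
have ea1 : 1 <= exp a by have := exp_ineq1_le a; lra.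
pose M := Z.to_nat (Int_part (exp a)).
have [M1 M2] : exp a <= INR M.+1 /\ INR M.+1 <= 2 * exp a.
  have [b1 b2] := base_Int_part (exp a).
  have z : (0 <= Int_part (exp a))%Z.
    suff : (-1 < Int_part (exp a))%Z by lia.
    by apply: lt_IZR; lra.
  by rewrite S_INR INR_IZR_INZ Z2Nat.id //; lra.
pose c := INR n * (J + de); pose d := INR n * (K - de).
have c0 : 0 <= c by apply: Rmult_le_pos; lra.
have hpn := seq_prob_pmf n hp; have [Q0 Q1] := seqQ_channel n hc.
have [enc [dec err]] := oneshot_coding hpn.1 hpn.2 Q0 Q1 B0 M d s0 c0.
have hT : (msgs n R0 * #|likelyY p dy n|.+1 <= msgs n RY)%nat.
  apply/leP; apply: INR_le; rewrite mult_INR S_INR.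
  have T1 := card_likelyY hp dy n; rewrite -/H in T1.
  have m0 := msgs_le n R0.
  have mY : exp (INR n * RY * ln 2) / 2 <= INR (msgs n RY).
    apply: msgs_ge; suff : 0 < RY by lra.
    by apply: (Rmult_lt_reg_r (ln 2)) => //; have := Rmult_le_pos _ _ r0 (Rlt_le _ _ l2); lra.
  set tY := exp (INR n * (H + dy)) in T1.
  have tY1 : 1 <= tY.
    have := exp_ineq1_le (INR n * (H + dy)); rewrite -/tY.
    by have : 0 <= INR n * (H + dy) by [apply: Rmult_le_pos; lra]; lra.
  have u0 := exp_pos (INR n * R0 * ln 2).
  have e : exp (INR n * RY * ln 2) * exp (- (INR n * dy)) = exp (INR n * R0 * ln 2) * tY.
    rewrite -!exp_plus; congr exp; rewrite Rmult_assoc dyE; ring.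
  have v0 := exp_pos (INR n * RY * ln 2).
  apply: (Rle_trans _ (exp (INR n * R0 * ln 2) * (2 * tY))).
    by apply: Rmult_le_compat; [exact: pos_INR|have := pos_INR #|likelyY p dy n|; lra|done|lra].
  by nra.
have [phi0 [phiX [phiY [psi hcode]]]] := code_of_side_information (R0 := R0) enc dec hq hT.
exists phi0, phiX, phiY, psi.
have g1 : exp (- (INR M.+1 * exp (- c))) <= exp (- (INR n * de)).
  have : exp (INR n * de) <= INR M.+1 * exp (- c).
    have -> : exp (INR n * de) = exp a * exp (- c).
      by rewrite -exp_plus; congr exp; rewrite /a /c; ring.
    by apply: Rmult_le_compat_r => //; left; exact: exp_pos.
  have := exp_ineq1_le (INR n * de) => i1 i2.
  have [lt|->] : - (INR M.+1 * exp (- c)) <= - (INR n * de) by lra.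
    by left; exact: exp_increasing.
  exact: Rle_refl.
have g2 : INR M.+1 / INR #|{: B}| * exp (- d) <= 8 * exp (- (INR n * de)).
  have ed := exp_pos (- d).
  have e : 2 * exp a * exp (- d) = 8 * exp (- (INR n * de)) * (exp (INR n * (J - K + 4 * de)) / 4).
    have -> : 8 * exp (- (INR n * de)) * (exp (INR n * (J - K + 4 * de)) / 4) =
      2 * (exp (- (INR n * de)) * exp (INR n * (J - K + 4 * de))) by field.
    by rewrite Rmult_assoc -!exp_plus; congr (2 * exp _); rewrite /a /d; ring.
  apply: (Rmult_le_reg_r (INR #|{: B}|)) => //.
  have -> : INR M.+1 / INR #|{: B}| * exp (- d) * INR #|{: B}| = INR M.+1 * exp (- d) by field; lra.
  apply: (Rle_trans _ (2 * exp a * exp (- d))); first by apply: Rmult_le_compat_r; lra.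
  rewrite e; apply: Rmult_le_compat_l => //.
  by have := exp_pos (- (INR n * de)); lra.
have g3 := t1 n; have g4 := Rmult_le_compat_l _ _ _ (Rlt_le _ _ (Rinv_0_lt_compat _ s0)) (t2 n).
have g5 := t3 n.
apply: Rle_trans hcode _.
have lin (x1 x2 x3 x4 x5 y2 : R) : x1 <= s + x2 + x3 + x4 + x5 ->
  x2 <= exp (- (INR n * de)) -> x3 <= 8 * exp (- (INR n * de)) -> x4 <= r1 ^ n ->
  x5 <= / s * r2 ^ n -> y2 <= r3 ^ n -> x1 + y2 <= eps.
  by have : eps = 5 * s by [rewrite /s; field]; lra.
exact: lin err g1 g2 g3 g4 g5.
Qed.

End Codes.

(** * Converse *)

Section Converse.
Variables (X Y A M : finType) (p : X -> Y -> R).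
Hypothesis hp : is_pmf p.
Variable n : nat.
Local Notation Xn := {ffun 'I_n -> X}.
Local Notation Yn := {ffun 'I_n -> Y}.
Variables (mu : Xn -> M) (U : 'I_n -> M -> Yn -> A).
Hypothesis U_upd : forall i m ys y, U i m (upd ys i y) = U i m ys.

Let p0 := hp.1.
Let W (xs : Xn) (ys : Yn) := seq_prob p xs ys.

Lemma resample_pair (i : 'I_n) (h : Xn -> Yn -> R) :
  \sum_xs \sum_ys W xs ys * h xs ys =
  \sum_x \sum_y p x y * \sum_xs \sum_ys W xs ys * h (upd xs i x) (upd ys i y).
Proof.
have w1 : \sum_(u : X * Y) p u.1 u.2 = 1 by rewrite -(pair_bigA _ p); exact: hp.2.
rewrite (sum_ffun_pair (fun xs ys => W xs ys * h xs ys)).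
transitivity (\sum_(z : {ffun 'I_n -> X * Y}) (\prod_j p (z j).1 (z j).2) *
  h [ffun k => (z k).1] [ffun k => (z k).2]).
  apply: eq_bigr => z _; congr (_ * _).
  by apply: eq_bigr => j _; rewrite !ffunE.
rewrite (resample w1 i (fun z => h [ffun k => (z k).1] [ffun k => (z k).2])).
rewrite pair_bigA; apply: eq_bigr => -[x y] _ /=; congr (_ * _).
rewrite (sum_ffun_pair (fun xs ys => W xs ys * h (upd xs i x) (upd ys i y))).
apply: eq_bigr => z _; congr (_ * _).
  by apply: eq_bigr => j _; rewrite !ffunE.
by congr (h _ _); apply/ffunP => k; rewrite !ffunE; case: eqP.
Qed.

(** The law of [U_i] given [X_i = x], obtained by overwriting the letter instead of dividing, so it
    is a channel even at letters of probability zero. *)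
Definition letter_channel (i : 'I_n) (x : X) (a : A) : R :=
  \sum_xs \sum_ys W xs ys * indic (U i (mu (upd xs i x)) ys = a).

Local Notation q := letter_channel.

Lemma sum_W : \sum_xs \sum_ys W xs ys = 1.
Proof. exact: (seq_prob_pmf n hp).2. Qed.

Lemma W_ge0 xs ys : 0 <= W xs ys.
Proof. by apply: prodR_ge0. Qed.

Lemma letter_channelP i : channel (q i).
Proof.
split=> [x a|x].
  apply: sumR_ge0 => xs; apply: sumR_ge0 => ys.
  by apply: Rmult_le_pos; [exact: W_ge0|exact: indic_ge0].
rewrite exchange_big -sum_W; apply: eq_bigr => xs _.
rewrite exchange_big; apply: eq_bigr => ys _ /=.
by rewrite -[RHS](sum_indic_eq (U i (mu (upd xs i x)) ys) (fun _ => W xs ys));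
  apply: eq_bigr => a _; rewrite Rmult_comm.
Qed.

(** This is the Markov chain U_i - X_i - Y_i: after the i-th pair is resampled, [U_upd] removes the
    new [y] from [U], which then depends on the new pair through [x] alone. *)
Lemma expect_letter i (phi : X -> Y -> A -> R) :
  \sum_xs \sum_ys W xs ys * phi (xs i) (ys i) (U i (mu xs) ys) =
  \sum_x \sum_y \sum_a p x y * q i x a * phi x y a.
Proof.
rewrite (resample_pair i (fun xs ys => phi (xs i) (ys i) (U i (mu xs) ys))).
apply: eq_bigr => x _; apply: eq_bigr => y _.
under [RHS]eq_bigr => a _ do rewrite Rmult_assoc.
rewrite -big_distrr /=; congr (_ * _); rewrite /letter_channel.
under [RHS]eq_bigr => a _ do rewrite big_distrl /=.
rewrite [RHS]exchange_big; apply: eq_bigr => xs _ /=.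
under [RHS]eq_bigr => a _ do rewrite big_distrl /=.
rewrite [RHS]exchange_big; apply: eq_bigr => ys _ /=.
under [RHS]eq_bigr => a _ do rewrite Rmult_assoc.
by rewrite -big_distrr /= sum_indic_eq !upd_same U_upd.
Qed.

Let t i x y a := q i x a * pY p y / outVY p (q i) a y.

Let tgt0 xs ys : 0 < W xs ys -> forall i, 0 < t i (xs i) (ys i) (U i (mu xs) ys).
Proof.
move=> W0 i.
have pp : 0 < p (xs i) (ys i) by apply: (prodR_gt0P (F := fun i => p (xs i) (ys i)) i).
have qq : 0 < q i (xs i) (U i (mu xs) ys).
  apply: Rlt_le_trans W0 _; rewrite /letter_channel.
  have nn xs' ys' : 0 <= W xs' ys' * indic (U i (mu (upd xs' i (xs i))) ys' = U i (mu xs) ys).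
    by apply: Rmult_le_pos; [exact: W_ge0|exact: indic_ge0].
  apply: (Rle_trans _ (W xs ys * indic (U i (mu (upd xs i (xs i))) ys = U i (mu xs) ys))).
    by rewrite upd_id indic1 //; lra.
  apply: Rle_trans (term_le_sumR ys (nn xs)) _.
  by apply: (term_le_sumR (F := fun xs' => \sum_ys' W xs' ys' * _) xs) => xs'; apply: sumR_ge0.
have [_ y0 _ vy0] := joint_gt0 hp (letter_channelP i) pp qq.
by apply: Rdiv_lt_0_compat => //; exact: Rmult_lt_0_compat.
Qed.

(* The single-letter informations sum to the mean of the logarithm of
   Z = prod_i P(x_i | u_i, y_i) / P(x_i | y_i); by Jensen this is at most ln E[Z],
   and E[Z] <= #|M| because for each message the conditional laws sum to at
   most one. *)
Lemma sum_cmi_letter_le : \sum_i cmi p (q i) <= ln (INR #|M|).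
Proof.
have [[x0 y0]] : inhabited (Xn * Yn).
  apply: NNPP => ni; have := sum_W; rewrite big1 => [|x _]; first by lra.
  by apply: big1 => y _; case: ni; exact: (inhabits (x, y)).
have cM : 0 < INR #|M|.
  by apply: lt_0_INR; apply/ltP; apply/card_gt0P; exists (mu x0).
pose Z (xs : Xn) (ys : Yn) := \prod_i t i (xs i) (ys i) (U i (mu xs) ys).
have -> : \sum_i cmi p (q i) =
    \sum_xs \sum_ys W xs ys * \sum_i ln (t i (xs i) (ys i) (U i (mu xs) ys)).
  transitivity (\sum_i \sum_xs \sum_ys W xs ys * ln (t i (xs i) (ys i) (U i (mu xs) ys))).
    apply: eq_bigr => i _; rewrite (expect_letter i (fun x y a => ln (t i x y a))).
    rewrite /cmi exchange_big; apply: eq_bigr => x _ /=.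
    by rewrite exchange_big.
  rewrite exchange_big; apply: eq_bigr => xs _; rewrite exchange_big; apply: eq_bigr => ys _ /=.
  by rewrite big_distrr.
have qch i := letter_channelP i.
have o0 i a y : 0 <= outVY p (q i) a y by apply: outVY_ge0 => //; exact: (qch i).1.
(* [r] is P(x | a, y). For a fixed message and fixed [ys] every [U i m ys] is constant, so the sum
   over [xs] factors into sums that are each at most 1. *)
pose r i x y a := p x y * q i x a / outVY p (q i) a y.
have r0 i x y a : 0 <= r i x y a.
  have num : 0 <= p x y * q i x a by apply: Rmult_le_pos => //; exact: (qch i).1.
  case: (o0 i a y) => [o1|e]; last by rewrite /r -e /Rdiv Rinv_0 Rmult_0_r; lra.
  by apply: Rmult_le_pos => //; left; exact: Rinv_0_lt_compat.
have r1 i y a : \sum_x r i x y a <= 1.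
  rewrite /r /Rdiv -big_distrl /= -/(outVY p (q i) a y).
  case: (o0 i a y) => [o1|<-]; last by lra.
  by right; apply: Rinv_r; lra.
have t0 i x y a : 0 <= t i x y a.
  have num : 0 <= q i x a * pY p y by apply: Rmult_le_pos; [exact: (qch i).1|exact: pY_ge0].
  case: (o0 i a y) => [o1|e]; last by rewrite /t -e /Rdiv Rinv_0 Rmult_0_r; lra.
  by apply: Rmult_le_pos => //; left; exact: Rinv_0_lt_compat.
have EZ : \sum_xs \sum_ys W xs ys * Z xs ys <= INR #|M|.
  apply: (Rle_trans _ (\sum_(ys : Yn) \sum_(xs : Xn) (\prod_i pY p (ys i)) *
      \sum_m \prod_i r i (xs i) (ys i) (U i m ys))).
    rewrite exchange_big; apply: sumR_le => ys; apply: sumR_le => xs.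
    have -> : W xs ys * Z xs ys =
      (\prod_i pY p (ys i)) * \prod_i r i (xs i) (ys i) (U i (mu xs) ys).
      rewrite /W /seq_prob /Z -!big_split /=; apply: eq_bigr => i _.
      by rewrite /t /r /Rdiv; ring.
    apply: Rmult_le_compat_l; first by apply: prodR_ge0 => i; apply: pY_ge0.
    apply: (term_le_sumR (F := fun m => \prod_i r i (xs i) (ys i) (U i m ys))) => m.
    exact: prodR_ge0.
  have -> : INR #|M| = \sum_(ys : Yn) (\prod_i pY p (ys i)) * INR #|M|.
    by rewrite -big_distrl /= (sum_prodR1 _ (sum_pY hp.2)) Rmult_1_l.
  apply: sumR_le => ys; rewrite -big_distrr /=.
  apply: Rmult_le_compat_l; first by apply: prodR_ge0 => i; apply: pY_ge0.
  rewrite exchange_big /= -[X in _ <= X]Rmult_1_r -sumR_const; apply: sumR_le => m.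
  rewrite (sum_prodR (fun i x => r i x (ys i) (U i m ys))).
  by apply: prodR_le1 => i; split=> //; apply: sumR_ge0.
(* Jensen in the form of the tangent to [ln] at [INR #|M|]. *)
apply: (Rle_trans _ (\sum_xs \sum_ys W xs ys * (ln (INR #|M|) - 1 + Z xs ys * / INR #|M|))).
  apply: sumR_le => xs; apply: sumR_le => ys.
  case: (W_ge0 xs ys) => [W0|<-]; last by lra.
  apply: Rmult_le_compat_l; first by lra.
  have tp := tgt0 W0; rewrite -ln_prodR // -/(Z xs ys).
  have Z0 : 0 < Z xs ys by apply: prodR_gt0.
  have Z1 : 0 < Z xs ys * / INR #|M| by apply: Rdiv_lt_0_compat.
  have := exp_ineq1_le (ln (Z xs ys * / INR #|M|)); rewrite exp_ln //.
  have -> : ln (Z xs ys * / INR #|M|) = ln (Z xs ys) - ln (INR #|M|) by exact: ln_div.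
  lra.
have -> : \sum_xs \sum_ys W xs ys * (ln (INR #|M|) - 1 + Z xs ys * / INR #|M|) =
  1 * (ln (INR #|M|) - 1) + (\sum_xs \sum_ys W xs ys * Z xs ys) * / INR #|M|.
  rewrite -sum_W !big_distrl -big_split; apply: eq_bigr => xs _ /=.
  by rewrite !big_distrl -big_split; apply: eq_bigr => ys _ /=; rewrite sum_W; ring.
have := Rmult_le_compat_r _ _ _ (Rlt_le _ _ (Rinv_0_lt_compat _ cM)) EZ.
rewrite Rinv_r; last by lra.
lra.
Qed.

End Converse.

Lemma converse_channel (X Y F : finType) (p : X -> Y -> R) (f : X -> Y -> F)
  (R0 RX RY : R) : is_pmf p -> achievable p f R0 RX RY -> forall eps, 0 < eps ->
  exists q : X -> {ffun Y -> F} -> R, [/\ channel q, cmi p q <= (R0 + RX) * ln 2 &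
    \sum_x \sum_y \sum_a p x y * q x a * indic (a y <> f x y) <= eps].
Proof.
move=> hp ach eps e0; have [n [n0 [phi0 [phiX [phiY [psi he]]]]]] : exists n : nat, 0 < INR n /\
    exists phi0 phiX phiY psi, @code_error X Y F p f n R0 RX RY phi0 phiX phiY psi <= eps.
  have [N /(_ N.+1 (leqnSn N)) h] := ach _ e0; exists N.+1; split=> //.
  by apply: lt_0_INR; apply/ltP.
pose M := ('I_(msgs n R0) * 'I_(msgs n RX))%type.
pose mu (xs : {ffun 'I_n -> X}) : M := (phi0 xs, phiX xs).
pose U (i : 'I_n) (m : M) (ys : {ffun 'I_n -> Y}) : {ffun Y -> F} :=
  [ffun y => psi m.2 (phiY (upd ys i y) m.1) i].
have Uu i m ys y : U i m (upd ys i y) = U i m ys.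
  by apply/ffunP => y'; rewrite !ffunE upd_upd.
have le := sum_cmi_letter_le hp mu Uu.
(* Only the information needs averaging over letters: a wrong letter makes a wrong block, so every
   letter error is at most the block error. *)
have [i hi] : exists i, cmi p (letter_channel p mu U i) <= (R0 + RX) * ln 2.
  apply: (exists_le_mean (w := fun _ => / INR n)) => [i||].
  - by left; exact: Rinv_0_lt_compat.
  - by rewrite sum_ord_const Rinv_r //; lra.
  rewrite -big_distrr /=; apply: (Rmult_le_reg_l (INR n)) => //.
  rewrite -Rmult_assoc Rinv_r ?Rmult_1_l; last by lra.
  apply: Rle_trans le _; rewrite card_prod !card_ord mult_INR.
  have [[x0 y0]] := pmf_inhabited hp.
  have m0 : 0 < INR (msgs n R0).
    by apply: lt_0_INR; apply/ltP; apply: leq_ltn_trans (ltn_ord (phi0 [ffun=> x0])).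
  have m1 : 0 < INR (msgs n RX).
    by apply: lt_0_INR; apply/ltP; apply: leq_ltn_trans (ltn_ord (phiX [ffun=> x0])).
  have ln_le a b : 0 < a -> a <= exp b -> ln a <= b.
    move=> a0 [lt|->]; last by rewrite ln_exp; lra.
    by left; rewrite -(ln_exp b); exact: ln_increasing.
  rewrite ln_mult //.
  have := ln_le _ _ m0 (msgs_le n R0); have := ln_le _ _ m1 (msgs_le n RX); lra.
exists (letter_channel p mu U i); split=> //; first exact: letter_channelP.
rewrite -(expect_letter hp mu Uu i (fun x y (a : {ffun Y -> F}) => indic (a y <> f x y))).
apply: Rle_trans he; apply: sumR_le => xs; apply: sumR_le => ys.
have W0 : 0 <= seq_prob p xs ys by apply: prodR_ge0 => j; exact: hp.1.
rewrite ffunE upd_id /=; case: ifP => [/eqP -> |_].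
  by rewrite indic0 ?ffunE; [lra|case].
by rewrite -[X in _ <= X]Rmult_1_r; apply: Rmult_le_compat_l => //; exact: indic_le1.
Qed.

(** * Compactness and continuity *)

Lemma Un_cv_const (c : R) : Un_cv (fun _ => c) c.
Proof. by move=> e e0; exists 0%nat => k _; rewrite R_dist_eq. Qed.

Lemma Un_cv_sum (I : finType) (u : I -> nat -> R) (l : I -> R) :
  (forall i, Un_cv (u i) (l i)) -> Un_cv (fun k => \sum_i u i k) (\sum_i l i).
Proof.
move=> h; elim: (index_enum I) => [|i s IH].
  rewrite big_nil; apply: (Un_cv_ext (fun _ => 0)); last exact: Un_cv_const.
  by move=> k; rewrite big_nil.
rewrite big_cons; apply: (Un_cv_ext (fun k => u i k + \big[Rplus/0]_(j <- s) u j k)).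
  by move=> k; rewrite big_cons.
exact: CV_plus.
Qed.

Lemma Un_cv_le_const (u : nat -> R) (l b : R) :
  Un_cv u l -> (forall k, u k <= b) -> l <= b.
Proof.
move=> h ub; apply: Rnot_lt_le => lt.
have [N /(_ N (le_n N))] := h (l - b) ltac:(lra).
by rewrite /R_dist; have := ub N; split_Rabs; lra.
Qed.

Lemma Un_cv_ge_const (u : nat -> R) (l b : R) :
  Un_cv u l -> (forall k, b <= u k) -> b <= l.
Proof.
move=> h ub; suff : - l <= - b by lra.
by apply: Un_cv_le_const (CV_opp _ _ h) _ => k; have := ub k; rewrite /opp_seq; lra.
Qed.

(** Reindexings are constrained by [k <= s k] only: this preserves limits, survives composition and
    is what choice delivers. *)
Lemma Un_cv_subseq (u : nat -> R) (l : R) (s : nat -> nat) :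
  (forall k, le k (s k)) -> Un_cv u l -> Un_cv (fun k => u (s k)) l.
Proof.
move=> hs h e e0; have [N hN] := h e e0; exists N => k hk; apply: hN.
by have := hs k; lia.
Qed.

Lemma Un_cv_inv : Un_cv (fun k => / (INR k + 1)) 0.
Proof.
move=> e e0; have [N [hN N0]] := archimed_cor1 e e0; exists N => k hk.
have k0 := pos_INR k.
have p : 0 < / (INR k + 1) by apply: Rinv_0_lt_compat; lra.
rewrite /R_dist Rminus_0_r Rabs_pos_eq; last by lra.
apply: Rlt_trans hN; apply: Rinv_lt_contravar.
  by apply: Rmult_lt_0_compat; [exact: lt_0_INR|lra].
by have := le_INR _ _ hk; lra.
Qed.

Lemma bounded_subseq1 (u : nat -> R) : (forall k, 0 <= u k <= 1) ->
  exists s l, (forall k, le k (s k)) /\ Un_cv (fun k => u (s k)) l.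
Proof.
move=> hu; have [l hl] := Bolzano_Weierstrass u _ (compact_P3 0 1) hu.
have ex k : exists j, le k j /\ Rabs (u j - l) < / (INR k + 1).
  have p : 0 < / (INR k + 1) by apply: Rinv_0_lt_compat; have := pos_INR k; lra.
  apply: (hl (fun x => Rabs (x - l) < / (INR k + 1)) k).
  by exists (mkposreal _ p) => x.
have [s hs] := choice _ ex.
exists s, l; split=> [k|e e0]; first by case: (hs k).
have [N hN] := Un_cv_inv e0; exists N => k /hN; rewrite /R_dist Rminus_0_r => h.
apply: Rlt_trans (hs k).2 _; apply: Rle_lt_trans h; exact: Rle_abs.
Qed.

Lemma bounded_subseq (T : finType) (u : nat -> T -> R) :
  (forall k t, 0 <= u k t <= 1) ->
  exists s l, (forall k, le k (s k)) /\ forall t, Un_cv (fun k => u (s k) t) (l t).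
Proof.
move=> hu.
suff [s [l [hs hl]]] : exists s l, (forall k, le k (s k)) /\
    forall t, t \in enum T -> Un_cv (fun k => u (s k) t) (l t).
  by exists s, l; split=> // t; apply: hl; rewrite mem_enum.
elim: (enum T) => [|t0 r [s [l [hs hl]]]].
  by exists (fun k => k), (fun _ => 0); split.
have [s' [l' [hs' hl']]] := bounded_subseq1 (fun k => hu (s k) t0).
exists (fun k => s (s' k)), (fun t => if t == t0 then l' else l t); split.
  by move=> k; have := hs (s' k); have := hs' k; lia.
move=> t; rewrite inE; case: eqP => [-> _|_ /= tr]; first exact: hl'.
exact: (@Un_cv_subseq (fun k => u (s k) t)) hs' (hl t tr).
Qed.

Lemma channel_le1 (X A : finType) (q : X -> A -> R) x a : channel q -> q x a <= 1.
Proof. by case=> q0 q1; rewrite -(q1 x); apply: (term_le_sumR (F := q x)). Qed.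

Lemma channel_subseq (X A : finType) (u : nat -> X -> A -> R) :
  (forall k, channel (u k)) ->
  exists s l, [/\ forall k, le k (s k), channel l &
    forall x a, Un_cv (fun k => u (s k) x a) (l x a)].
Proof.
move=> hu.
have [|s [l [hs hl]]] := @bounded_subseq (X * A)%type (fun k z => u k z.1 z.2).
  by move=> k [x a]; split; [exact: (hu k).1|exact: channel_le1].
exists s, (fun x a => l (x, a)); split=> //; last by move=> x a; exact: (hl (x, a)).
split=> [x a|x].
  by apply: Un_cv_ge_const (hl (x, a)) _ => k; exact: (hu _).1.
apply: (UL_sequence (fun k => \sum_a u (s k) x a)).
  by apply: Un_cv_sum => a; exact: (hl (x, a)).
apply: (Un_cv_ext (fun _ => 1)); last exact: Un_cv_const.
by move=> k; rewrite (hu _).2.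
Qed.

Definition xlnx (t : R) : R := t * ln t.

Lemma xlnx_cv (u : nat -> R) (l : R) : (forall k, 0 <= u k) -> Un_cv u l ->
  Un_cv (fun k => xlnx (u k)) (xlnx l).
Proof.
move=> u0 h; have [l0|l0] := Un_cv_ge_const h u0.
  apply: CV_mult => //; apply: (continuity_seq ln u l) => //.
  by apply: derivable_continuous_pt; exists (/ l); exact: derivable_pt_lim_ln.
rewrite -l0 /xlnx Rmult_0_l => e e0.
(* The bound below is 2 sqrt u, which is under [e] once u < (e/2)^2; the 1 makes [ln (u k)]
   negative. *)
pose m := Rmin 1 ((e / 2) ^ 2).
have m0 : 0 < m by apply: Rmin_pos; [lra|apply: pow_lt; lra].
have [N hN] := h m m0; exists N => k /hN.
rewrite -l0 /R_dist !Rminus_0_r (Rabs_pos_eq (u k)) // => lt.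
case: (u0 k) => [p|<-]; last by rewrite Rmult_0_l Rabs_R0.
have lt1 : u k < 1 by apply: Rlt_le_trans lt _; exact: Rmin_l.
have lt2 : u k < (e / 2) ^ 2 by apply: Rlt_le_trans lt _; exact: Rmin_r.
pose r := sqrt (u k).
have r0 : 0 < r by exact: sqrt_lt_R0.
have rr : r * r = u k by apply: sqrt_sqrt; lra.
(* -ln u = 2 ln (1/r) <= 2/r with r = sqrt u, hence |u ln u| <= 2 r. *)
have lr : - ln r <= / r.
  rewrite -ln_Rinv //; have ir := Rinv_0_lt_compat _ r0.
  have := exp_ineq1_le (ln (/ r)); rewrite exp_ln //; lra.
have ln0 : ln (u k) < 0 by rewrite -ln_1; exact: ln_increasing.
have lu : ln (u k) = 2 * ln r by rewrite -rr ln_mult //; lra.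
have re : 2 * r < e by nra.
rewrite Rabs_left; last by nra.
have -> : - (u k * ln (u k)) = 2 * (r * r * - ln r) by rewrite lu -rr; ring.
have : r * r * - ln r <= r * r * / r by apply: Rmult_le_compat_l => //; nra.
have -> : r * r * / r = r by field; lra.
lra.
Qed.

(** * Continuity and data processing for conditional information *)

Section CmiProperties.
Variables (X Y A : finType) (p : X -> Y -> R).
Hypothesis hp : is_pmf p.
Let p0 := hp.1.

(** Splitting the logarithm removes the quotient, whose denominator may tend to 0, and reduces
    continuity to that of [xlnx]. *)
Lemma cmi_xlnx (q : X -> A -> R) : channel q ->
  cmi p q = \sum_x \sum_a pX p x * xlnx (q x a)
    + - \sum_a \sum_y xlnx (outVY p q a y) + \sum_y xlnx (pY p y).
Proof.
move=> hq.
have -> : \sum_x \sum_a pX p x * xlnx (q x a) =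
  \sum_a \sum_x \sum_y p x y * q x a * ln (q x a).
  rewrite exchange_big; apply: eq_bigr => a _; apply: eq_bigr => x _.
  by rewrite /pX big_distrl; apply: eq_bigr => y _ /=; rewrite /xlnx; ring.
have -> : \sum_a \sum_y xlnx (outVY p q a y) =
  \sum_a \sum_x \sum_y p x y * q x a * ln (outVY p q a y).
  apply: eq_bigr => a _; rewrite exchange_big; apply: eq_bigr => y _ /=.
  by rewrite /xlnx {1}/outVY big_distrl.
have -> : \sum_y xlnx (pY p y) = \sum_a \sum_x \sum_y p x y * q x a * ln (pY p y).
  rewrite exchange_big.
  transitivity (\sum_x \sum_y p x y * ln (pY p y)).
    by rewrite exchange_big; apply: eq_bigr => y _; rewrite /xlnx {1}/pY big_distrl.
  apply: eq_bigr => x _; rewrite exchange_big; apply: eq_bigr => y _ /=.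
  by rewrite -big_distrl -big_distrr /= hq.2 Rmult_1_r.
rewrite -sumR_opp -!sumR_add; apply: eq_bigr => a _.
rewrite -sumR_opp -!sumR_add; apply: eq_bigr => x _.
rewrite -sumR_opp -!sumR_add; apply: eq_bigr => y _.
case: (p0 x y) => [pp|<-]; last by ring.
case: (hq.1 x a) => [qq|<-]; last by ring.
have [_ y0 _ vy0] := joint_gt0 hp hq pp qq.
by rewrite ln_div ?ln_mult //; [ring|exact: Rmult_lt_0_compat].
Qed.

Lemma cmi_cv (u : nat -> X -> A -> R) (l : X -> A -> R) :
  (forall k, channel (u k)) -> channel l ->
  (forall x a, Un_cv (fun k => u k x a) (l x a)) ->
  Un_cv (fun k => cmi p (u k)) (cmi p l).
Proof.
move=> hu hl h; rewrite cmi_xlnx //.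
apply: (Un_cv_ext (fun k => \sum_x \sum_a pX p x * xlnx (u k x a)
    + - \sum_a \sum_y xlnx (outVY p (u k) a y) + \sum_y xlnx (pY p y))).
  by move=> k; rewrite cmi_xlnx.
apply: CV_plus; last exact: Un_cv_const.
apply: CV_plus.
  apply: Un_cv_sum => x; apply: Un_cv_sum => a; apply: CV_mult; first exact: Un_cv_const.
  by apply: xlnx_cv => // k; exact: (hu k).1.
apply: (CV_opp (fun k => \sum_a \sum_y xlnx (outVY p (u k) a y))).
apply: Un_cv_sum => a; apply: Un_cv_sum => y; apply: xlnx_cv.
  by move=> k; apply: outVY_ge0 => //; exact: (hu k).1.
by apply: Un_cv_sum => x; apply: CV_mult; [exact: Un_cv_const|].
Qed.

Variables (B : finType) (S : A -> B).

Definition push (q : X -> A -> R) (x : X) (b : B) : R :=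
  \sum_a indic (S a = b) * q x a.

Lemma sum_push (q : X -> A -> R) x (phi : B -> R) :
  \sum_b push q x b * phi b = \sum_a q x a * phi (S a).
Proof.
under eq_bigr => b _ do rewrite /push big_distrl /=.
rewrite exchange_big; apply: eq_bigr => a _ /=.
rewrite -(sum_indic_eq (S a) (fun b => q x a * phi b)).
by apply: eq_bigr => b _; ring.
Qed.

Lemma push_channel q : channel q -> channel (push q).
Proof.
case=> q0 q1; split=> [x b|x].
  by apply: sumR_ge0 => a; apply: Rmult_le_pos => //; exact: indic_ge0.
rewrite -(q1 x); have := sum_push q x (fun _ => 1).
by under eq_bigr => b _ do rewrite Rmult_1_r; under [RHS]eq_bigr => b _ do rewrite Rmult_1_r.
Qed.

Lemma le_push (q : X -> A -> R) x a : channel q -> q x a <= push q x (S a).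
Proof.
case=> q0 q1; have := @term_le_sumR A (fun a' => indic (S a' = S a) * q x a') a.
rewrite indic1 // Rmult_1_l; apply=> a'.
by apply: Rmult_le_pos => //; exact: indic_ge0.
Qed.

(** The difference is a divergence between [q] and the kernel [b] below, hence nonnegative by
    [gibbs_term]. *)
Lemma data_processing (q : X -> A -> R) : channel q -> cmi p (push q) <= cmi p q.
Proof.
move=> hq; have hr := push_channel hq; set r := push q.
have o0 a y : 0 <= outVY p q a y by apply: outVY_ge0 => //; exact: hq.1.
have or0 b y : 0 <= outVY p r b y by apply: outVY_ge0 => //; exact: hr.1.
have -> : cmi p r = \sum_a \sum_x \sum_y p x y * q x a *
    ln (r x (S a) * pY p y / outVY p r (S a) y).
  rewrite /cmi exchange_big [RHS]exchange_big; apply: eq_bigr => x _ /=.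
  rewrite exchange_big [RHS]exchange_big; apply: eq_bigr => y _ /=.
  under eq_bigr => b _ do rewrite Rmult_assoc.
  under [RHS]eq_bigr => a _ do rewrite Rmult_assoc.
  rewrite -!big_distrr /=; congr (_ * _).
  exact: (sum_push q x (fun b => ln (r x b * pY p y / outVY p r b y))).
(* The law of [a] when its label is drawn from [r x], and then [a] given that label and [y]. *)
pose b x y a := outVY p q a y * r x (S a) / outVY p r (S a) y.
have sb : \sum_a \sum_x \sum_y p x y * b x y a <= 1.
  have <- : \sum_a \sum_y outVY p q a y = 1.
    rewrite exchange_big -(sum_pY hp.2); apply: eq_bigr => y _; exact: (sum_outVY_V p hq.2).
  apply: sumR_le => a; rewrite exchange_big; apply: sumR_le => y /=.
  have -> : \sum_x p x y * b x y a =
    outVY p q a y * / outVY p r (S a) y * \sum_x p x y * r x (S a).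
    by rewrite big_distrr; apply: eq_bigr => x _ /=; rewrite /b /Rdiv; ring.
  rewrite -/(outVY p r (S a) y) Rmult_assoc (Rmult_comm (/ _)).
  case: (or0 (S a) y) => [h|<-]; first by rewrite Rinv_r; lra.
  by rewrite Rmult_0_l Rmult_0_r.
have sq : \sum_a \sum_x \sum_y p x y * q x a = 1.
  rewrite exchange_big -hp.2; apply: eq_bigr => x _ /=; rewrite exchange_big.
  by apply: eq_bigr => y _ /=; rewrite -big_distrr /= hq.2 Rmult_1_r.
suff : \sum_a \sum_x \sum_y p x y * q x a *
    ln (r x (S a) * pY p y / outVY p r (S a) y) +
    (\sum_a \sum_x \sum_y p x y * q x a + - \sum_a \sum_x \sum_y p x y * b x y a) <= cmi p q by lra.
rewrite -sumR_opp -!sumR_add; apply: sumR_le => a.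
rewrite -sumR_opp -!sumR_add; apply: sumR_le => x.
rewrite -sumR_opp -!sumR_add; apply: sumR_le => y.
case: (p0 x y) => [pp|<-]; last by lra.
rewrite !Rmult_assoc -Ropp_mult_distr_r_reverse -!Rmult_plus_distr_l.
apply: Rmult_le_compat_l; first by lra.
have b0 : 0 <= b x y a.
  case: (or0 (S a) y) => [h|e]; last by rewrite /b -e /Rdiv Rinv_0; lra.
  apply: Rmult_le_pos; first by apply: Rmult_le_pos => //; exact: hr.1.
  by left; exact: Rinv_0_lt_compat.
case: (hq.1 x a) => [qq|<-]; last by lra.
have rr : 0 < r x (S a) by apply: Rlt_le_trans qq _; exact: le_push.
have [_ y0 _ vy0] := joint_gt0 hp hq pp qq.
have [_ _ _ ry0] := joint_gt0 hp hr pp rr.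
have bb : 0 < b x y a by apply: Rdiv_lt_0_compat => //; exact: Rmult_lt_0_compat.
have gibbs := gibbs_term (hq.1 x a) b0 (fun _ => bb).
have mulgt0 c d : 0 < c -> 0 < d -> 0 < c * d by exact: Rmult_lt_0_compat.
have lnb : ln (b x y a) = ln (outVY p q a y) + ln (r x (S a)) - ln (outVY p r (S a) y).
  by rewrite ln_div ?ln_mult //; exact: mulgt0.
rewrite ln_div // lnb in gibbs.
rewrite !ln_div ?ln_mult //; try exact: mulgt0.
lra.
Qed.

End CmiProperties.

(** Data processing down to a one-point alphabet, where every weighted logarithm is [ln 1]. *)
Lemma cmi_ge0 (X Y A : finType) (p : X -> Y -> R) (q : X -> A -> R) :
  is_pmf p -> channel q -> 0 <= cmi p q.
Proof.
move=> hp hq; apply: Rle_trans (data_processing hp (fun _ => tt) hq).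
right; symmetry; apply: big1 => -[] _; apply: big1 => x _; apply: big1 => y _.
have r1 x' : push (fun _ : A => tt) q x' tt = 1.
  by rewrite -(hq.2 x'); apply: eq_bigr => a _; rewrite indic1 // Rmult_1_l.
have -> : outVY p (push (fun _ : A => tt) q) tt y = pY p y.
  by apply: eq_bigr => x' _; rewrite r1 Rmult_1_r.
rewrite r1; case: (hp.1 x y) => [pp|<-]; last by ring.
have y0 : 0 < pY p y.
  apply: Rlt_le_trans pp _; apply: (term_le_sumR (F := fun x => p x y)) => x'; exact: hp.1.
by rewrite Rmult_1_l /Rdiv Rinv_r ?ln_1; [ring|lra].
Qed.

(** * The conditional graph entropy *)

Section GraphEntropy.
Variables (X Y F : finType) (p : X -> Y -> R) (f : X -> Y -> F).
Hypothesis hp : is_pmf p.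

Let l2 : 0 < ln 2.
Proof. by have := ln_lt_2; lra. Qed.

Lemma condMI_cmi (q : X -> {set X} -> R) : channel q -> condMI p q = cmi p q / ln 2.
Proof.
move=> hq; rewrite /condMI /cmi /Rdiv big_distrl; apply: eq_bigr => v _ /=.
rewrite big_distrl; apply: eq_bigr => x _ /=.
rewrite big_distrl; apply: eq_bigr => y _ /=.
rewrite -[pVY p q v y]/(outVY p q v y) /pVXY; case: Rlt_dec => [h|h] /=; last first.
  suff -> : p x y * q x v = 0 by ring.
  by apply: Rle_antisym; [exact: Rnot_lt_le|apply: Rmult_le_pos; [exact: hp.1|exact: hq.1]].
have pp : 0 < p x y.
  by case: (hp.1 x y) => // e; move: h; rewrite -e Rmult_0_l; lra.
have qq : 0 < q x v.
  by case: (hq.1 x v) => // e; move: h; rewrite -e Rmult_0_r; lra.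
have [_ _ _ o0] := joint_gt0 hp hq pp qq.
rewrite /log2 /Rdiv -Rmult_assoc; congr (_ * ln _ * _).
by field; lra.
Qed.

(** The choice V = {X}, showing that the minimum runs over a nonempty set. *)
Definition singleton_channel (x : X) (v : {set X}) : R := indic ([set x] = v).

Lemma singleton_admissible : admissible p f singleton_channel.
Proof.
have pos x v : 0 < pX p x * singleton_channel x v -> [set x] = v.
  by move=> h; apply: NNPP => ne; move: h; rewrite /singleton_channel (indic0 ne) Rmult_0_r; lra.
split; [|split; [|split]].
- by move=> x v; exact: indic_ge0.
- move=> x; rewrite -[RHS](sum_indic_eq [set x] (fun _ => 1)).
  by apply: eq_bigr => v _; rewrite Rmult_1_r.
- move=> x v /pos <- x1 x2 /set1P -> /set1P -> [y [_ ne]]; exact: ne.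
- by move=> x v /pos <-; exact: set11.
Qed.

(** A pair [x], [v] charged by the limit is charged by some [u k], and the two support conditions
    concern only the pair. *)
Lemma admissible_limit (u : nat -> X -> {set X} -> R) (l : X -> {set X} -> R) :
  (forall k, admissible p f (u k)) -> channel l ->
  (forall x v, Un_cv (fun k => u k x v) (l x v)) -> admissible p f l.
Proof.
move=> hu hl h.
have pos x v : 0 < pX p x * l x v -> exists k, 0 < pX p x * u k x v.
  move=> lt; apply: NNPP => /not_ex_all_not ne.
  have : pX p x * l x v <= 0; last by lra.
  apply: (Un_cv_le_const (u := fun k => pX p x * u k x v)) => [|k].
    by apply: CV_mult => //; exact: Un_cv_const.
  exact/Rnot_lt_le/ne.
split; [exact: hl.1|split; [exact: hl.2|split]] => x v /pos[k].
- by case: (hu k) => _ [_ [h1 _]]; exact: h1.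
- by case: (hu k) => _ [_ [_ h1]]; exact: h1.
Qed.

(** [epsilon] returns the intended number only if the minimum is attained. This follows from
    compactness of the channels, closedness of admissibility and continuity of [cmi]. *)
Lemma condGraphEntropyP : is_condGraphEntropy p f (condGraphEntropy p f).
Proof.
apply: epsilon_spec.
(* [completeness] provides suprema, hence the sign. *)
pose E r := exists q, admissible p f q /\ r = - cmi p q.
have bE : bound E.
  exists 0 => r [q [/admissible_channel hq ->]].
  by have := cmi_ge0 hp hq; lra.
have nE : exists r, E r by exists (- cmi p singleton_channel), singleton_channel; split=> //; exact: singleton_admissible.
have [m [ub lub]] := completeness E bE nE.
have ex k : exists q, admissible p f q /\ cmi p q <= - m + / (INR k + 1).
  apply: NNPP => /not_ex_all_not ne.
  have ik : 0 < / (INR k + 1) by apply: Rinv_0_lt_compat; have := pos_INR k; lra.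
  suff : m <= m - / (INR k + 1) by lra.
  apply: lub => r [q [hq ->]]; apply: Rnot_lt_le => lt; apply: (ne q); split=> //; lra.
have [u hu] := choice _ ex.
have uc k := admissible_channel (hu k).1.
have [s [l [hs lc hl]]] := channel_subseq uc.
have la : admissible p f l by apply: (@admissible_limit (fun k => u (s k))) => // k; exact: (hu _).1.
have cv : Un_cv (fun k => cmi p (u (s k))) (cmi p l) by apply: cmi_cv => // k; exact: uc.
have le : cmi p l <= - m.
  suff : cmi p l - (- m + 0) <= 0 by lra.
  apply: (Un_cv_le_const (u := fun k => cmi p (u (s k)) - (- m + / (INR (s k) + 1)))).
    apply: CV_minus => //; apply: CV_plus; first exact: Un_cv_const.
    exact: (Un_cv_subseq hs Un_cv_inv).
  by move=> k; have := (hu (s k)).2; lra.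
exists (condMI p l); split; first by exists l.
move=> q hq; rewrite !condMI_cmi //; last exact: admissible_channel hq.
apply: Rmult_le_compat_r; first by left; exact: Rinv_0_lt_compat.
by have := ub (- cmi p q) (ex_intro _ q (conj hq erefl)); lra.
Qed.

Definition consistent (a : {ffun Y -> F}) : {set X} :=
  [set x | [forall y, (if Rlt_dec 0 (p x y) then true else false) ==> (f x y == a y)]].

Lemma in_consistent a x : x \in consistent a <-> forall y, 0 < p x y -> f x y = a y.
Proof.
rewrite inE; split=> [/forallP h y pp|h].
  by have := h y; case: Rlt_dec => // _ /= /eqP.
by apply/forallP => y; case: Rlt_dec => //= pp; apply/eqP; exact: h.
Qed.

Lemma consistent_independent a : independent p f (consistent a).
Proof.
move=> x1 x2 /in_consistent h1 /in_consistent h2 [y [pp ne]]; apply: ne.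
have [a1 a2] := (hp.1 x1 y, hp.1 x2 y).
have b1 : 0 < p x1 y by case: a1 => // e; move: pp; rewrite -e Rmult_0_l; lra.
have b2 : 0 < p x2 y by case: a2 => // e; move: pp; rewrite -e Rmult_0_r; lra.
by rewrite h1 // h2.
Qed.

Lemma condGraphEntropy_le_cmi (q : X -> {ffun Y -> F} -> R) : channel q ->
  \sum_x \sum_y \sum_a p x y * q x a * indic (a y <> f x y) = 0 ->
  condGraphEntropy p f * ln 2 <= cmi p q.
Proof.
move=> hq err; apply: Rle_trans (data_processing hp consistent hq).
have hr := push_channel consistent hq.
have t0 x y a : 0 <= p x y * q x a * indic (a y <> f x y).
  by apply: Rmult_le_pos; [apply: Rmult_le_pos; [exact: hp.1|exact: hq.1]|exact: indic_ge0].
have supp x a : 0 < q x a -> x \in consistent a.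
  move=> qq; apply/in_consistent => y pp; apply: NNPP => ne.
  have e1 := sumR_eq0 x (fun x => sumR_ge0 xpredT (fun y => sumR_ge0 xpredT (t0 x y))) err.
  have e2 := sumR_eq0 y (fun y => sumR_ge0 xpredT (t0 x y)) e1.
  have := sumR_eq0 a (t0 x y) e2; rewrite indic1; last by move=> e; apply: ne.
  by have := Rmult_lt_0_compat _ _ pp qq; lra.
have ex x v : 0 < pX p x * push consistent q x v -> exists a, v = consistent a /\ x \in v.
  move=> h; apply: NNPP => /not_ex_all_not ne.
  suff e : push consistent q x v = 0 by move: h; rewrite e Rmult_0_r; lra.
  apply: big1 => a _; case: (classic (consistent a = v)) => [e|/indic0 ->]; last by ring.
  case: (hq.1 x a) => [qq|<-]; last by ring.
  by case: (ne a); rewrite -e; split=> //; exact: supp.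
have adm : admissible p f (push consistent q).
  split; [exact: hr.1|split; [exact: hr.2|split]] => x v /ex[a [e xv]] //.
  by rewrite e; exact: consistent_independent.
have := condGraphEntropyP.2 _ adm; rewrite condMI_cmi // => le.
have -> : cmi p (push consistent q) = cmi p (push consistent q) / ln 2 * ln 2 by field; lra.
by apply: Rmult_le_compat_r => //; lra.
Qed.

Lemma achievable_sum_rate (R0 RX RY : R) :
  achievable p f R0 RX RY -> condGraphEntropy p f <= R0 + RX.
Proof.
move=> ach.
pose err (q : X -> {ffun Y -> F} -> R) :=
  \sum_x \sum_y \sum_a p x y * q x a * indic (a y <> f x y).
have ex (k : nat) : exists q, [/\ channel q, cmi p q <= (R0 + RX) * ln 2 & err q <= / (INR k + 1)].
  by apply: (converse_channel hp ach); apply: Rinv_0_lt_compat; have := pos_INR k; lra.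
have [u hu] := choice _ ex.
have uc k : channel (u k) by case: (hu k).
have [s [l [hs lc hl]]] := channel_subseq uc.
have cv : Un_cv (fun k => cmi p (u (s k))) (cmi p l) by apply: cmi_cv => // k; exact: uc.
have le : cmi p l <= (R0 + RX) * ln 2.
  by apply: Un_cv_le_const cv _ => k; case: (hu (s k)).
have e0 : err l = 0.
  apply: Rle_antisym.
    suff : err l - 0 <= 0 by lra.
    apply: (Un_cv_le_const (u := fun k => err (u (s k)) - / (INR (s k) + 1))).
      apply: CV_minus; last exact: (Un_cv_subseq hs Un_cv_inv).
      apply: Un_cv_sum => x; apply: Un_cv_sum => y; apply: Un_cv_sum => a.
      apply: CV_mult; last exact: Un_cv_const.
      by apply: CV_mult => //; exact: Un_cv_const.
    by move=> k; case: (hu (s k)) => _ _; lra.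
  apply: sumR_ge0 => x; apply: sumR_ge0 => y; apply: sumR_ge0 => a.
  by apply: Rmult_le_pos; [apply: Rmult_le_pos; [exact: hp.1|exact: lc.1]|exact: indic_ge0].
have := condGraphEntropy_le_cmi lc e0 => h.
by apply: (Rmult_le_reg_r (ln 2)) => //; lra.
Qed.

Lemma msgs_gt0_rate_ge0 n r : (0 < n)%nat -> (0 < msgs n r)%nat -> 0 <= r.
Proof.
move=> n0 m0; apply: Rnot_lt_le => r0.
have nn : 0 < INR n by apply: lt_0_INR; apply/ltP.
have m1 : 1 <= INR (msgs n r) by apply: (le_INR 1); apply/leP.
have := msgs_le n r; have : exp (INR n * r * ln 2) < 1; last by lra.
rewrite -exp_0; apply: exp_increasing.
have := Rmult_lt_0_compat _ _ (Rmult_lt_0_compat _ _ nn (Ropp_0_gt_lt_contravar _ r0)) l2; lra.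
Qed.

(** A negative rate makes the message set empty, and no encoder maps a nonempty set of sequences
    into it. *)
Lemma achievable_rates_ge0 (R0 RX RY : R) :
  achievable p f R0 RX RY -> [/\ 0 <= R0, 0 <= RX & 0 <= RY].
Proof.
move=> ach; have [N /(_ N.+1 (leqnSn N))] := ach 1 ltac:(lra).
move=> [phi0 [phiX [phiY [psi _]]]]; have [[x y]] := pmf_inhabited hp.
pose xs : {ffun 'I_N.+1 -> X} := [ffun=> x]; pose ys : {ffun 'I_N.+1 -> Y} := [ffun=> y].
split; apply: (@msgs_gt0_rate_ge0 N.+1) => //.
- exact: leq_ltn_trans (ltn_ord (phi0 xs)).
- exact: leq_ltn_trans (ltn_ord (phiX xs)).
- exact: leq_ltn_trans (ltn_ord (phiY ys (phi0 xs))).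
Qed.

End GraphEntropy.

Theorem theorem4 (X Y F : finType) (p : X -> Y -> R) (f : X -> Y -> F)
  (hp : is_pmf p) (R0 RX RY : R) :
  RY > R0 + entropyY p ->
  (rate_region p f R0 RX RY <->
   (0 <= R0 /\ 0 <= RX /\ 0 <= RY /\ R0 + RX >= condGraphEntropy p f)).
Proof.
move=> hY; have l2 : 0 < ln 2 by have := ln_lt_2; lra.
split=> [reg|[r0 [rx [ry sum]]] eps e0].
  have approx eps : 0 < eps -> [/\ - eps <= R0, - eps <= RX, - eps <= RY &
      condGraphEntropy p f - eps <= R0 + RX].
    (* Half of [eps], because the deviations of [R0] and [RX] add up in the sum rate. *)
    move=> e0; have [a [b [c [ach [ha [hb hc]]]]]] := reg (eps / 2) ltac:(lra).
    have [a0 b0 c0] := achievable_rates_ge0 hp ach; have := achievable_sum_rate hp ach.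
    by move: ha hb hc; split_Rabs; split; lra.
  have lim a b : (forall eps, 0 < eps -> a - eps <= b) -> a <= b.
    by move=> h; apply: Rnot_lt_le => lt; have := h ((a - b) / 2) ltac:(lra); lra.
  have R0_ge0 : 0 <= R0 by apply: lim => e /approx[]; lra.
  have RX_ge0 : 0 <= RX by apply: lim => e /approx[]; lra.
  have RY_ge0 : 0 <= RY by apply: lim => e /approx[]; lra.
  have sum : condGraphEntropy p f <= R0 + RX by apply: lim => e /approx[].
  by do !split=> //; lra.
(* Raising all rates equally preserves the strict inequality on [RY] and makes the one on the sum
   rate strict. *)
exists (R0 + eps), (RX + eps), (RY + eps); split; last by split_Rabs; lra.
have [[q [adm hq]] _] := condGraphEntropyP f hp.
apply: (achievable_of_channel hp adm); try lra.
have hc := admissible_channel adm.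
have -> : cmi p q = condGraphEntropy p f * ln 2 by rewrite -hq condMI_cmi //; field; lra.
by apply: Rmult_lt_compat_r; lra.
Qed.
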